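(* Let $(X_j)_{j\ge1}$ be associated, centered, square integrable real random variables. Suppose that: (i) there is a measurable function $a:[0,1]\to\mathbb{R}$ with $a(0)=0$ such that for all $0\le s_1<s_2\le t_1<t_2\le1$, as $n\to+\infty$, $$\frac{1}{s_n^2}\mathrm{Var}\left(\sum_{h=[ns_1]+1}^{[ns_2]}X_h+\sum_{h=[nt_1]+1}^{[nt_2]}X_h\right)\longrightarrow\{a(s_2)-a(s_1)\}+\{a(t_2)-a(t_1)\};$$ (ii) for all $0\le s<t\le1$, the moving partial sums $\sum_{h=[ns]+1}^{[nt]}X_h$ satisfy the block hypotheses (L), (H0), (Ha), (Hab), (Hb) and the moving Lindeberg condition, as spelled out in the context. Then the sequence of stochastic processes $\{Y_n(t),\,0\le t\le1\}$ converges weakly in finite distributions (i.e. all finite-dimensional marginals converge in distribution) to $\{W(a(t)),\,0\le t\le1\}$, where $\{W(t),\,0\le t\le 1\}$ is a standard Wiener process.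
   Context: Random variables $X_1,X_2,\dots$ are associated if for every $n$ and all bounded coordinatewise non-decreasing measurable $f,g:\mathbb{R}^n\to\mathbb{R}$, $\mathrm{Cov}(f(X_1,\dots,X_n),g(X_1,\dots,X_n))\ge0$. Notation: $[x]$ is the integer part of $x$, $S_0=0$, $S_n=\sum_{k=1}^nX_k$, $s_n^2=\mathrm{Var}(S_n)$ with $s_n>0$ for $n$ large, and $$Y_n(t)=\frac{S_{[nt]}}{s_n}\mathbf 1_{\{nt\ge1\}},\quad t\in[0,1].$$ Block hypotheses for the window determined by $0\le s<t\le 1$. Put $p(n)=[ns]$, $N(n)=[nt]-[ns]$, and $(s_n')^2=\mathrm{Var}\left(\sum_{h=p(n)+1}^{p(n)+N(n)}X_h\right)$ (positive for $n$ large). There are integers $\ell(n)\ge1$, $m(n)\ge 0$, $r(n)$ (possibly depending on $s,t$) with $N(n)=m(n)\ell(n)+r(n)$, $0\le r(n)<\ell(n)$ and $m(n)\to+\infty$ such that, with the block sums $$D_{j,n}=\sum_{h=p(n)+(j-1)\ell(n)+1}^{p(n)+j\ell(n)}X_h,\quad1\le j\le m(n),$$ as $n\to+\infty$: (L) $\ \ell(n)/N(n)\to0$; (H0) $\ \ell(n)/(s_n')^2\to0$; (Ha) $\ \dfrac{1}{(s_n')^2}\sum_{j=1}^{m(n)}\mathrm{Var}(D_{j,n})\to1$; (Hab) $\ \dfrac{1}{(s_n')^2}\mathrm{Var}\left(\sum_{h=p(n)+m(n)\ell(n)+1}^{p(n)+N(n)}X_h\right)\to0$; (Hb) $\ \sup_{1\le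 j\le m(n)}\dfrac{1}{(s_n')^2}\mathrm{Var}(D_{j,n})\to0$. Moving Lindeberg condition: with $(\tau_n')^2=\sum_{j=1}^{m(n)}\mathrm{Var}(D_{j,n})$, for every $\varepsilon>0$, $$\frac{1}{(s_n')^2}\sum_{j=1}^{m(n)}\int_{\{|D_{j,n}|\ge\varepsilon\tau_n'\}}|D_{j,n}|^2\,d\mathbb{P}\longrightarrow0\quad\text{as } n\to+\infty .$$ *)

(* Defs.v *)
From HB Require Import structures.
From mathcomp Require Export all_boot all_order all_algebra.
From mathcomp Require Export all_classical all_reals all_analysis.
Export Order.TTheory GRing.Theory Num.Theory.
Export numFieldNormedType.Exports.

Set Implicit Arguments.
Unset Strict Implicit.
Unset Printing Implicit Defensive.

Local Open Scope classical_set_scope.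
Local Open Scope ring_scope.

(* Sequences of random variables are written [X : nat -> {RV P >-> R}] and are
   indexed from 1, as in the mathematical text: the value [X 0] never occurs in
   any of the definitions below. *)

Section association.
Context d (T : measurableType d) (R : realType) (P : probability T R).

Definition coordinatewise_nondecreasing n (f : n.-tuple R -> R) :=
  forall x y : n.-tuple R,
    (forall i, tnth x i <= tnth y i) -> f x <= f y.

Definition associated (X : nat -> {RV P >-> R}) :=
  forall (n : nat) (f g : n.-tuple R -> R),
    measurable_fun setT f -> measurable_fun setT g ->
    bounded_fun f -> bounded_fun g ->
    coordinatewise_nondecreasing f -> coordinatewise_nondecreasing g ->
    (0 <= covariance P (fun w => f [tuple X i.+1 w | i < n])
                       (fun w => g [tuple X i.+1 w | i < n]))%E.

End association.

Section partial_sums.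
Context d (T : measurableType d) (R : realType) (P : probability T R).

(* Real-valued variance: agrees with ['V_P[Y]] for square integrable [Y]. *)
Definition var (Y : T -> R) : R := fine 'V_P[Y].

Variable X : nat -> {RV P >-> R}.

(* X_(p+1) + ... + X_q *)
Definition psum (p q : nat) : T -> R :=
  fun w => \sum_(p.+1 <= h < q.+1) X h w.

Definition stdev_S (n : nat) : R := Num.sqrt (var (psum 0 n)).

(* Integer part [nt]; [Num.truncn] is the floor since only t >= 0 is used. *)
Definition ipart (n : nat) (t : R) : nat := Num.truncn (n%:R * t).

Definition Yproc (n : nat) (t : R) : T -> R :=
  fun w => psum 0 (ipart n t) w / stdev_S n * (1 <= n%:R * t)%R%:R.

End partial_sums.

Section moving_blocks.
Context d (T : measurableType d) (R : realType) (P : probability T R).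
Variables (X : nat -> {RV P >-> R}) (s t : R).

Definition window_start (n : nat) : nat := ipart n s.

Definition window_size (n : nat) : nat := (ipart n t - ipart n s)%N.

(* (s'_n)^2 *)
Definition window_var (n : nat) : R :=
  var P (psum X (window_start n) (window_start n + window_size n)).

(* D_(j,n), for j >= 1 *)
Definition block_sum (l : nat -> nat) (j n : nat) : T -> R :=
  psum X (window_start n + j.-1 * l n) (window_start n + j * l n).

Definition block_tail (l m : nat -> nat) (n : nat) : T -> R :=
  psum X (window_start n + m n * l n) (window_start n + window_size n).

(* (tau'_n)^2 *)
Definition block_var (l m : nat -> nat) (n : nat) : R :=
  \sum_(1 <= j < (m n).+1) var P (block_sum l j n).

Definition moving_lindeberg (l m : nat -> nat) :=
  forall eps : R, 0 < eps ->
    (window_var n)^-1 * (\sum_(1 <= j < (m n).+1)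
       \int[P]_(w in [set w | eps * Num.sqrt (block_var l m n)
                              <= `|block_sum l j n w| ])
         (`|block_sum l j n w| ^+ 2)) @[n --> \oo] --> (0 : R).

Record block_conditions (l m r : nat -> nat) : Prop := BlockConditions {
  blocks_pos : forall n, (1 <= l n)%N ;
  blocks_div : forall n, window_size n = (m n * l n + r n)%N ;
  blocks_rem : forall n, (r n < l n)%N ;
  blocks_infty : m @ \oo --> \oo ;
  blocks_var_pos : \forall n \near \oo, 0 < window_var n ;
  blocks_L : (l n)%:R / (window_size n)%:R @[n --> \oo] --> (0 : R) ;
  blocks_H0 : (l n)%:R / window_var n @[n --> \oo] --> (0 : R) ;
  blocks_Ha : block_var l m n / window_var n @[n --> \oo] --> (1 : R) ;
  blocks_Hab :
    var P (block_tail l m n) / window_var n @[n --> \oo] --> (0 : R) ;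
  (* all the terms are nonnegative, so that starting the maximum at 0 only
     matters when it is taken over the empty family *)
  blocks_Hb :
    \big[Num.max/0]_(1 <= j < (m n).+1)
      (var P (block_sum l j n) / window_var n) @[n --> \oo] --> (0 : R) ;
  blocks_lindeberg : moving_lindeberg l m
}.

Definition block_hypotheses := exists l m r, block_conditions l m r.

End moving_blocks.

Section wiener.
Context d (T : measurableType d) (R : realType) (Q : probability T R).

(* Mutual independence of a finite family; the product rule for subfamilies is
   obtained by taking [B i = setT] for the other indices. *)
Definition independent_RVs k (Z : 'I_k -> T -> R) :=
  forall B : 'I_k -> set R, (forall i, measurable (B i)) ->
    Q (\bigcap_(i in [set: 'I_k]) (Z i @^-1` B i)) =
    (\prod_(i < k) Q (Z i @^-1` B i))%E.

(* Standard Wiener process on the time interval [0, 1]; the values of [W t] for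
   t outside of [0, 1] are irrelevant. The second parameter of [normal_prob] is
   the standard deviation. *)
Record standard_wiener (W : R -> {RV Q >-> R}) : Prop := StandardWiener {
  wiener0 : {ae Q, forall w, W 0 w = 0} ;
  wiener_continuous :
    {ae Q, forall w, {within `[0, 1], continuous (fun t : R => W t w)}} ;
  wiener_normal : forall s t : R, 0 <= s -> s < t -> t <= 1 ->
    forall B : set R, measurable B ->
      Q ((W t \- W s) @^-1` B) = normal_prob 0 (Num.sqrt (t - s)) B ;
  wiener_independent : forall (k : nat) (t : nat -> R),
    0 <= t 0%N -> (forall i, (i < k)%N -> t i < t i.+1) -> t k <= 1 ->
    independent_RVs (fun i : 'I_k => W (t i.+1) \- W (t i))
}.

End wiener.

Section weak_convergence.
Context d (T : measurableType d) d' (T' : measurableType d') (R : realType).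
Variables (P : probability T R) (Q : probability T' R).

Definition cvg_in_distribution k
    (Y : nat -> T -> 'rV[R]_k) (Z : T' -> 'rV[R]_k) :=
  forall f : 'rV[R]_k -> R, continuous f -> bounded_fun f ->
    ('E_P[f \o Y n] @[n --> \oo] --> 'E_Q[f \o Z])%E.

(* Convergence of the finite-dimensional distributions of processes indexed by
   [0, 1]. *)
Definition cvg_fdd (Y : nat -> R -> T -> R) (Z : R -> T' -> R) :=
  forall (k : nat) (t : 'I_k -> R), (forall i, 0 <= t i <= 1) ->
    cvg_in_distribution (fun n w => \row_i Y n (t i) w)
                        (fun w => \row_i Z (t i) w).

End weak_convergence.

(* Main.v *)
Require Import Defs.
From mathcomp Require Import measurable_realfun ring lra.

(** Take a partition 0 = u_0 < ... < u_q of [0, 1] containing the given times;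
    the marginals of Y_n and of W o a are then one and the same linear image of
    the vector of increments over the partition, and it is enough to compare the
    two vectors of increments. Two tools carry the proof, one inequality for
    associated variables and Stein's method.

    The inequality ([dominated_cov]) is Newman's: if the oscillation of U is
    dominated by that of F and the oscillation of V by that of G, in the
    coordinatewise order of the X_j, then |Cov(U, V)| <= Cov(F, G). Indeed F + U,
    F - U, G + V and G - V are nondecreasing functions of the X_j, and the
    covariances between them are nonnegative. A Lipschitz function of a sum of
    X_j is dominated by a multiple of that sum, and a product of Lipschitz
    functions with values in [0, 1] by the sum of the multiples. So covariances of
    nonlinear functionals are controlled by covariances of partial sums.

    Independence of the increments. The hypothesis on variances makes, by polarization, the
    covariances of two disjoint increments tend to 0, and the inequality turns
    this into factorization of the mean of a product of Lipschitz functions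
    ([asymptotic_independence]).

    Law of one increment. If the limit variance is 0 the increment tends to 0 in
    mean square. Otherwise let S be the sum of the blocks xi_j of the window,
    divided by s_n. In E[S f(S)] = sum_j E[xi_j f(S)] one expands f around
    S_j = S - xi_j: the term E[xi_j f(S_j)] and the replacement of
    E[xi_j^2 f'(S_j)] by E[xi_j^2] E[f'(S_j)] cost covariances of xi_j and
    S_j, whose sum is Var S - sum_j Var xi_j and tends to 0; the Taylor
    remainders and the truncations cost Lindeberg tails ([stein_one],
    [stein_sum], [stein_limit]). Hence E[s^2 f'(S) - S f(S)] tends to 0, where
    s^2 is the limit variance, and this determines the limit law ([stein_clt])
    because s^2 f' - x f = h can be solved explicitly ([stein_equation]); solving
    it only for compactly supported h with Gaussian mean 0 makes f compactly
    supported too, so that all bounds on f come from compactness.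

    Back to vectors. A continuous function on R^q is approximated, uniformly on
    cubes, by combinations of products of one-variable bumps on a grid, and the
    boundedness of the variances gives tightness ([weak_cvg_product_test]). The
    products of bumps factorize in the limit as just seen, and exactly for the
    independent increments of W ([wiener_increments_mean]). *)

Set Implicit Arguments.
Unset Strict Implicit.
Unset Printing Implicit Defensive.

Local Open Scope classical_set_scope.
Local Open Scope ring_scope.

(** * Real-valued means and covariances *)
Section mean.
Context d (T : measurableType d) (R : realType) (P : probability T R).
Implicit Types (U V : T -> R).

Definition mean U : R := \int[P]_w U w.

Definition cov U V : R := mean (fun w => U w * V w) - mean U * mean V.

Lemma expectation_mean U : U \in Lfun P 1 -> ('E_P[U] = (mean U)%:E)%E.
Proof.
move=> lU; rewrite /mean /Rintegral -(@fineK _ 'E_P[U]) ?expectation_fin_num//.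
by rewrite unlock.
Qed.

Lemma Lfun_measurable p U : U \in Lfun P p -> measurable_fun setT U.
Proof. by rewrite inE => /andP[]; rewrite inE. Qed.

Lemma Lfun1_dominated U V : measurable_fun setT U -> V \in Lfun P 1 ->
  (forall w, `|U w| <= V w) -> U \in Lfun P 1.
Proof.
move=> mU /Lfun1_integrable iV UV; apply/Lfun1_integrable.
apply: le_integrable iV => //; first exact/measurable_EFinP.
by move=> w _ /=; rewrite lee_fin (le_trans (UV w))// ler_norm.
Qed.

Lemma Lfun1_bounded U C : measurable_fun setT U -> (forall w, `|U w| <= C) ->
  U \in Lfun P 1.
Proof. by move=> mU UC; exact: (Lfun1_dominated mU (Lfun_cst P C 1)). Qed.

Lemma Lfun2_bounded U C : measurable_fun setT U -> (forall w, `|U w| <= C) ->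
  U \in Lfun P 2%:E.
Proof.
move=> mU UC; rewrite inE; apply/andP; split; rewrite inE//=.
rewrite /finite_norm unlock poweR_lty//.
have [w _] : [set: T] !=set0.
  apply/set0P/negP => /eqP T0; have := probability_setT P.
  by rewrite T0 measure0 => /esym/eqP; rewrite onee_eq0.
apply: (@le_lt_trans _ _ (\int[P]_w (C ^+ 2)%:E)%E).
  apply: ge0_le_integral => //.
  - by move=> x _; rewrite poweR_ge0.
  - apply/measurable_EFinP.
    apply: (@measurableT_comp _ _ _ _ _ _ (@powR R ^~ 2)) => //.
    exact: measurableT_comp.
  - move=> x _ /=; rewrite lee_fin powR_mulrn// lerXn2r// ?nnegrE//.
    exact: le_trans (UC x).
by rewrite integral_cst//= probability_setT mule1 ltry.
Qed.

Lemma Lfun21 U : U \in Lfun P 2%:E -> U \in Lfun P 1.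
Proof. by apply: (@Lfun_subset12 _ _ _ P); rewrite fin_num_measure. Qed.

Lemma Lfun2_sqr U : U \in Lfun P 2%:E -> (fun w => U w ^+ 2) \in Lfun P 1.
Proof.
move=> lU; have := Lfun2_mul_Lfun1 lU lU.
by apply: eq_ind; congr (_ \in _); apply/funext => w; rewrite /= expr2.
Qed.

Lemma Lfun2_mul U V : U \in Lfun P 2%:E -> V \in Lfun P 2%:E ->
  (fun w => U w * V w) \in Lfun P 1.
Proof. exact: Lfun2_mul_Lfun1. Qed.


Lemma LfunD p U V : (1 <= p)%E -> U \in Lfun P p -> V \in Lfun P p ->
  (fun w => U w + V w) \in Lfun P p.
Proof. by move=> p1; case: (Lfun_submod_closed P p1) => _ h lU lV;
  have := h 1 _ _ lU lV; rewrite scale1r. Qed.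

Lemma LfunZ p k U : (1 <= p)%E -> U \in Lfun P p ->
  (fun w => k * U w) \in Lfun P p.
Proof. by move=> p1; case: (Lfun_submod_closed P p1) => l0 h lU;
  have := h k _ _ lU l0; rewrite addr0. Qed.

Lemma LfunB p U V : (1 <= p)%E -> U \in Lfun P p -> V \in Lfun P p ->
  (fun w => U w - V w) \in Lfun P p.
Proof.
move=> p1 lU lV.
have -> : (fun w => U w - V w) = (fun w => U w + -1 * V w).
  by apply/funext => w; rewrite mulN1r.
exact: LfunD p1 lU (LfunZ (-1) p1 lV).
Qed.

Lemma Lfun_sum p (I : Type) (r : seq I) (A : pred I) (F : I -> T -> R) :
  (1 <= p)%E -> (forall i, A i -> F i \in Lfun P p) ->
  (fun w => \sum_(i <- r | A i) F i w) \in Lfun P p.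
Proof.
move=> p1 lF; elim: r => [|i r IH].
  under eq_fun do rewrite big_nil; by case: (Lfun_submod_closed P p1).
under eq_fun do rewrite big_cons.
by case: (boolP (A i)) => // Ai; apply: LfunD => //; exact: lF.
Qed.

Lemma meanD U V : U \in Lfun P 1 -> V \in Lfun P 1 ->
  mean (fun w => U w + V w) = mean U + mean V.
Proof. by move=> /Lfun1_integrable iU /Lfun1_integrable iV; exact: RintegralD. Qed.

Lemma meanB U V : U \in Lfun P 1 -> V \in Lfun P 1 ->
  mean (fun w => U w - V w) = mean U - mean V.
Proof. by move=> /Lfun1_integrable iU /Lfun1_integrable iV; exact: RintegralB. Qed.

Lemma meanZ k U : U \in Lfun P 1 -> mean (fun w => k * U w) = k * mean U.
Proof. by move=> /Lfun1_integrable iU; exact: RintegralZl. Qed.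

Lemma mean_cst k : mean (fun=> k) = k.
Proof.
have := expectation_mean (Lfun_cst P k 1); rewrite expectation_cst.
by move=> [<-].
Qed.

Lemma mean_sum (I : Type) (r : seq I) (A : pred I) (F : I -> T -> R) :
  (forall i, A i -> F i \in Lfun P 1) ->
  mean (fun w => \sum_(i <- r | A i) F i w) = \sum_(i <- r | A i) mean (F i).
Proof.
move=> lF; elim: r => [|i r IH].
  by under [X in mean X]eq_fun do rewrite big_nil; rewrite mean_cst big_nil.
under [X in mean X]eq_fun do rewrite big_cons.
rewrite big_cons; case: ifPn => // Ai.
by rewrite meanD ?IH//; [exact: lF|exact: Lfun_sum].
Qed.

Lemma mean_le U V : U \in Lfun P 1 -> V \in Lfun P 1 ->
  (forall w, U w <= V w) -> mean U <= mean V.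
Proof.
by move=> /Lfun1_integrable iU /Lfun1_integrable iV UV; exact: le_Rintegral.
Qed.

Lemma mean_ge0 U : (forall w, 0 <= U w) -> 0 <= mean U.
Proof. by move=> U0; apply: Rintegral_ge0. Qed.

Lemma mean_norm_le U V : U \in Lfun P 1 -> V \in Lfun P 1 ->
  (forall w, `|U w| <= V w) -> `|mean U| <= mean V.
Proof.
move=> lU lV UV; apply: (@le_trans _ _ (mean (fun w => `|U w|))).
  by apply: le_normr_Rintegral => //; exact/Lfun1_integrable.
by apply: mean_le => //; exact: Lfun_norm.
Qed.

Lemma mean_normB_le U V W : U \in Lfun P 1 -> V \in Lfun P 1 ->
  W \in Lfun P 1 -> (forall w, `|U w - V w| <= W w) ->
  `|mean U - mean V| <= mean W.
Proof.
by move=> lU lV lW UVW; rewrite -meanB//; apply: mean_norm_le => //; exact: LfunB.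
Qed.

Lemma mean_dominated_cvg (U_ : nat -> T -> R) U V :
  (forall n, measurable_fun setT (U_ n)) -> measurable_fun setT U ->
  V \in Lfun P 1 -> (forall n w, `|U_ n w| <= V w) ->
  (forall w, U_ n w @[n --> \oo] --> U w) ->
  mean (U_ n) @[n --> \oo] --> mean U.
Proof.
move=> mU_ mU /Lfun1_integrable iV UV UU.
have UE : {ae P, forall w, [set: T] w ->
    (EFin \o U_ n) w @[n --> \oo] --> (EFin \o U) w}.
  by apply: aeW => w _; apply: cvg_EFin; [exact: nearW|exact: UU].
have UVE : {ae P, forall w n, [set: T] w ->
    (`|(EFin \o U_ n) w| <= (EFin \o V) w)%E}.
  by apply: aeW => w n _; rewrite lee_fin UV.
have mUE n : measurable_fun setT (EFin \o U_ n) by exact/measurable_EFinP.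
have mE : measurable_fun setT (EFin \o U) by exact/measurable_EFinP.
have [iU _ cU] := dominated_convergence measurableT mUE mE UE iV UVE.
apply: fine_cvg; rewrite fineK//; exact: integrable_fin_num.
Qed.

Lemma mean_indic A : measurable A -> mean \1_A = fine (P A).
Proof.
by move=> mA; rewrite /mean /Rintegral integral_indic// setIT.
Qed.

Lemma covC U V : cov U V = cov V U.
Proof.
by rewrite /cov [mean U * _]mulrC; congr (mean _ - _);
  apply/funext => w; rewrite mulrC.
Qed.

Lemma covariance_cov U V : U \in Lfun P 2%:E -> V \in Lfun P 2%:E ->
  (covariance P U V = (cov U V)%:E)%E.
Proof.
move=> lU lV; have lUV := Lfun2_mul lU lV.
rewrite (covarianceE (Lfun21 lU) (Lfun21 lV) lUV).
rewrite (expectation_mean (Lfun21 lU)) (expectation_mean (Lfun21 lV)).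
by rewrite (expectation_mean lUV).
Qed.

Lemma var_cov U : U \in Lfun P 2%:E -> var P U = cov U U.
Proof. by move=> lU; rewrite /var /variance covariance_cov. Qed.

Lemma cov_centered U V : mean U = 0 -> cov U V = mean (fun w => U w * V w).
Proof. by rewrite /cov => ->; rewrite mul0r subr0. Qed.

Lemma covDl U V W : U \in Lfun P 2%:E -> V \in Lfun P 2%:E ->
  W \in Lfun P 2%:E -> cov (fun w => U w + V w) W = cov U W + cov V W.
Proof.
move=> lU lV lW; rewrite /cov meanD ?Lfun21//.
under [X in mean X - _]eq_fun do rewrite mulrDl.
by rewrite meanD ?Lfun2_mul//; ring.
Qed.

Lemma covDr U V W : U \in Lfun P 2%:E -> V \in Lfun P 2%:E ->
  W \in Lfun P 2%:E -> cov W (fun w => U w + V w) = cov W U + cov W V.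
Proof. by move=> lU lV lW; rewrite !(covC W) covDl. Qed.

Lemma covZl k U V : U \in Lfun P 2%:E -> V \in Lfun P 2%:E ->
  cov (fun w => k * U w) V = k * cov U V.
Proof.
move=> lU lV; rewrite /cov meanZ ?Lfun21//.
under [X in mean X - _]eq_fun do rewrite -mulrA.
by rewrite meanZ ?Lfun2_mul//; ring.
Qed.

Lemma covZr k U V : U \in Lfun P 2%:E -> V \in Lfun P 2%:E ->
  cov U (fun w => k * V w) = k * cov U V.
Proof. by move=> lU lV; rewrite covC covZl// covC. Qed.

Lemma cov_sumr (I : Type) (r : seq I) (A : pred I) (F : I -> T -> R) U :
  U \in Lfun P 2%:E -> (forall i, A i -> F i \in Lfun P 2%:E) ->
  cov U (fun w => \sum_(i <- r | A i) F i w) = \sum_(i <- r | A i) cov U (F i).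
Proof.
move=> lU lF; elim: r => [|i r IH].
  under [X in cov _ X]eq_fun do rewrite big_nil.
  rewrite big_nil /cov mean_cst mulr0 subr0.
  by under [X in mean X]eq_fun do rewrite mulr0; rewrite mean_cst.
under [X in cov _ X]eq_fun do rewrite big_cons.
rewrite big_cons; case: ifPn => // Ai.
rewrite covDr ?IH//; first exact: lF.
by apply: Lfun_sum => //; rewrite lee_fin ler1n.
Qed.

End mean.
Arguments mean {d T R} P U.
Arguments cov {d T R} P U V.

(** * Lipschitz functions, clamps and ramps *)
Section lipschitz.
Context {R : realType}.

Definition lipschitz_fun (L : R) (h : R -> R) :=
  forall x y, `|h x - h y| <= L * `|x - y|.

Lemma lipschitz_ge0 L h : lipschitz_fun L h -> 0 <= L.
Proof. by move=> /(_ 1 0); rewrite subr0 normr1 mulr1; exact: le_trans. Qed.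

Lemma lipschitz_continuous L h : lipschitz_fun L h -> continuous h.
Proof.
move=> hL x; apply/cvgrPdist_le => e e0; have L0 := lipschitz_ge0 hL.
near=> y; apply: le_trans (hL x y) _.
apply: (@le_trans _ _ (L * (e / (L + 1)))).
  apply: ler_wpM2l => //; near: y.
  by apply: cvgr_dist_le => //; rewrite divr_gt0// ltr_wpDl.
by rewrite mulrA ler_pdivrMr ?ltr_wpDl// mulrC ler_pM2l//; lra.
Unshelve. all: by end_near. Qed.

Lemma lipschitz_measurable L h : lipschitz_fun L h -> measurable_fun setT h.
Proof. by move=> /lipschitz_continuous; exact: continuous_measurable_fun. Qed.

End lipschitz.

Section clamp.
Context {R : realType}.

(** Truncation at level [M]: association only speaks of bounded functions, and
    square integrable ones are reached through their truncations. *)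
Definition clamp (M x : R) : R := Num.max (- M) (Num.min M x).

Lemma clamp_homo M : {homo clamp M : x y / x <= y}.
Proof.
move=> x y xy; rewrite /clamp ge_max le_max lexx/= le_max; apply/orP; right.
by rewrite le_min ge_min lexx/= ge_min xy orbT.
Qed.

Lemma clamp_norm M x : 0 <= M -> `|clamp M x| <= `|x|.
Proof.
move=> M0; rewrite ler_norml /clamp.
have := ler_norm x; have := ler_norm (- x); rewrite normrN.
by case: (leP M x) => h1; [case: (leP (- M) M)|case: (leP (- M) x)] => h2 *;
  apply/andP; split; lra.
Qed.

Lemma clamp_bounded M x : 0 <= M -> `|clamp M x| <= M.
Proof.
move=> M0; rewrite ler_norml /clamp.
by case: (leP M x) => h1; [case: (leP (- M) M)|case: (leP (- M) x)] => h2;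
  apply/andP; split; lra.
Qed.

Lemma clamp_id M x : `|x| <= M -> clamp M x = x.
Proof.
rewrite ler_norml => /andP[h1 h2]; rewrite /clamp; case: (leP M x) => h3;
  [case: (leP (- M) M)|case: (leP (- M) x)] => h4; lra.
Qed.

Lemma measurable_clamp M : measurable_fun setT (clamp M).
Proof. by apply: measurable_maxr => //; exact: measurable_minr. Qed.

Lemma clamp_cvg x : clamp n%:R x @[n --> \oo] --> x.
Proof.
apply: cvg_near_cst; near=> n; apply: clamp_id.
by near: n; exact: nbhs_infty_ger.
Unshelve. all: by end_near. Qed.

Definition ramp (x : R) : R := Num.max 0 (Num.min 1 x).

Lemma ramp_itv x : 0 <= ramp x <= 1.
Proof.
rewrite /ramp; case: (leP 1 x) => h1;
  [case: (leP 0 1)|case: (leP 0 x)] => h2; apply/andP; split; lra.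
Qed.

Lemma ramp_id x : 0 <= x <= 1 -> ramp x = x.
Proof.
move=> /andP[h3 h4]; rewrite /ramp; case: (leP 1 x) => h1;
  [case: (leP 0 1)|case: (leP 0 x)] => h2; lra.
Qed.

Lemma ramp_ge1 x : 1 <= x -> ramp x = 1.
Proof.
move=> h3; rewrite /ramp; case: (leP 1 x) => h1;
  [case: (leP 0 1)|case: (leP 0 x)] => h2; lra.
Qed.

Lemma ramp_le0 x : x <= 0 -> ramp x = 0.
Proof.
move=> h3; rewrite /ramp; case: (leP 1 x) => h1;
  [case: (leP 0 1)|case: (leP 0 x)] => h2; lra.
Qed.

Lemma ramp_homo : {homo ramp : x y / x <= y}.
Proof.
move=> x y xy; rewrite /ramp.
(case: (leP 1 x) => h1; [case: (leP 0 1)|case: (leP 0 x)]) => h2;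
  (case: (leP 1 y) => h3; [case: (leP 0 1)|case: (leP 0 y)]) => h4 *; lra.
Qed.

Lemma ramp_dist x y : `|ramp x - ramp y| <= `|x - y|.
Proof.
rewrite ler_norml /ramp.
have := ler_norm (x - y); have := ler_norm (- (x - y)); rewrite normrN.
(case: (leP 1 x) => h1; [case: (leP 0 1)|case: (leP 0 x)]) => h2;
  (case: (leP 1 y) => h3; [case: (leP 0 1)|case: (leP 0 y)]) => h4 *;
  apply/andP; split; lra.
Qed.

End clamp.

(** * Covariance inequality for associated variables *)
Section association.
Context d (T : measurableType d) (R : realType) (P : probability T R).
Variable X : nat -> {RV P >-> R}.
Implicit Types (U V F G : T -> R).

Definition sample n w : n.-tuple R := [tuple X i.+1 w | i < n].

Definition isotone n U := exists u : n.-tuple R -> R,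
  [/\ measurable_fun setT u, coordinatewise_nondecreasing u & U = u \o sample n].

Lemma measurable_sample n : measurable_fun setT (sample n).
Proof.
apply/measurable_fun_tnthP => i.
rewrite (_ : _ \o _ = X i.+1); first exact: measurable_funP.
by apply/funext => w /=; rewrite tnth_mktuple.
Qed.

(** Newman's order between functionals of an associated sequence. The inequality
    is required of the representing functions on the whole of R^n, not only on the
    values taken by the sample, so that [F + U] and [F - U] are again isotone. *)
Definition dominated n U F := exists u f : n.-tuple R -> R,
  [/\ measurable_fun setT u, measurable_fun setT f,
      U = u \o sample n, F = f \o sample n &
      forall x y : n.-tuple R, (forall i, tnth x i <= tnth y i) ->
        `|u y - u x| <= f y - f x].

Lemma isotone_measurable n U : isotone n U -> measurable_fun setT U.
Proof.
by move=> [u [mu _ ->]]; apply: measurableT_comp => //; exact: measurable_sample.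
Qed.

(** Truncation at height [k] keeps monotonicity and makes the functions bounded,
    and the covariances of the truncations converge by dominated convergence. *)
Lemma isotone_cov n U V : associated X -> isotone n U -> isotone n V ->
  U \in Lfun P 2%:E -> V \in Lfun P 2%:E -> 0 <= cov P U V.
Proof.
move=> assoc iU iV lU lV.
have mU := isotone_measurable iU; have mV := isotone_measurable iV.
have mclamp M (W : T -> R) : measurable_fun setT W -> measurable_fun setT (clamp M \o W).
  by move=> mW; apply: measurableT_comp => //; exact: measurable_clamp.
have ccov k : 0 <= cov P (clamp k%:R \o U) (clamp k%:R \o V).
  case: iU iV => u [mu u_nd UE] [v [mv v_nd VE]].
  have := @assoc n (clamp k%:R \o u) (clamp k%:R \o v).
  have bc (z : n.-tuple R -> R) : bounded_fun (clamp k%:R \o z).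
    exists k%:R; split; first exact: num_real.
    move=> M kM x _ /=; apply: le_trans (ltW kM).
    exact: clamp_bounded.
  have ndc (z : n.-tuple R -> R) : coordinatewise_nondecreasing z ->
      coordinatewise_nondecreasing (clamp k%:R \o z).
    by move=> z_nd x y xy; apply: clamp_homo; exact: z_nd.
  have mc (z : n.-tuple R -> R) : measurable_fun setT z ->
      measurable_fun setT (clamp k%:R \o z).
    by move=> mz; apply: measurableT_comp => //; exact: measurable_clamp.
  move=> /(_ (mc _ mu) (mc _ mv) (bc _) (bc _) (ndc _ u_nd) (ndc _ v_nd)).
  have lc (W : T -> R) : measurable_fun setT W -> (clamp k%:R \o W) \in Lfun P 2%:E.
    move=> mW; apply: (@Lfun2_bounded _ _ _ _ _ k%:R); first exact: mclamp.
    by move=> w; exact: clamp_bounded.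
  have := covariance_cov (lc _ mU) (lc _ mV).
  by rewrite {1}UE {1}VE /comp /sample => ->; rewrite lee_fin.
suff : cov P (clamp k%:R \o U) (clamp k%:R \o V) @[k --> \oo] --> cov P U V.
  by move=> /cvgr_to_ge; apply; exact: nearW.
apply: cvgB; last apply: cvgM.
- apply: (@mean_dominated_cvg _ _ _ _ _ _ (fun w => `|U w * V w|)) => //=.
  + by move=> k; apply: measurable_funM; exact: mclamp.
  + exact: measurable_funM.
  + by apply: Lfun_norm; exact: Lfun2_mul.
  + by move=> k w /=; rewrite !normrM ler_pM ?clamp_norm.
  + by move=> w; apply: cvgM; exact: clamp_cvg.
- apply: (@mean_dominated_cvg _ _ _ _ _ _ (fun w => `|U w|)) => //=.
  + by move=> k; exact: mclamp.
  + by apply: Lfun_norm; exact: Lfun21.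
  + by move=> k w /=; rewrite clamp_norm.
  + by move=> w; exact: clamp_cvg.
- apply: (@mean_dominated_cvg _ _ _ _ _ _ (fun w => `|V w|)) => //=.
  + by move=> k; exact: mclamp.
  + by apply: Lfun_norm; exact: Lfun21.
  + by move=> k w /=; rewrite clamp_norm.
  + by move=> w; exact: clamp_cvg.
Qed.

Lemma dominated_isotoneD n U F : dominated n U F -> isotone n (fun w => F w + U w).
Proof.
move=> [u [f [mu mf -> -> uf]]]; exists (fun x => f x + u x); split => //.
  exact: measurable_funD.
by move=> x y xy; have := uf x y xy; rewrite ler_norml => /andP[]; lra.
Qed.

Lemma dominated_isotoneB n U F : dominated n U F -> isotone n (fun w => F w - U w).
Proof.
move=> [u [f [mu mf -> -> uf]]]; exists (fun x => f x - u x); split => //.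
  exact: measurable_funB.
by move=> x y xy; have := uf x y xy; rewrite ler_norml => /andP[]; lra.
Qed.

(** Adding the nonnegative covariances Cov(F + U, G - V) and Cov(F - U, G + V)
    gives Cov(U, V) <= Cov(F, G); the other two sign patterns give the lower
    bound. *)
Lemma dominated_cov n U F V G : associated X ->
  U \in Lfun P 2%:E -> F \in Lfun P 2%:E ->
  V \in Lfun P 2%:E -> G \in Lfun P 2%:E ->
  dominated n U F -> dominated n V G -> `|cov P U V| <= cov P F G.
Proof.
move=> assoc lU lF lV lG UF VG.
have l2 : (1 <= 2%:E :> \bar R)%E by rewrite lee_fin ler1n.
have iU1 := dominated_isotoneD UF; have iU2 := dominated_isotoneB UF.
have iV1 := dominated_isotoneD VG; have iV2 := dominated_isotoneB VG.
have lU1 := LfunD l2 lF lU; have lU2 := LfunB l2 lF lU.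
have lV1 := LfunD l2 lG lV; have lV2 := LfunB l2 lG lV.
have := isotone_cov assoc iU1 iV1 lU1 lV1.
have := isotone_cov assoc iU2 iV2 lU2 lV2.
have := isotone_cov assoc iU1 iV2 lU1 lV2.
have := isotone_cov assoc iU2 iV1 lU2 lV1.
have covB A B C : A \in Lfun P 2%:E -> B \in Lfun P 2%:E -> C \in Lfun P 2%:E ->
    cov P (fun w => A w - B w) C = cov P A C - cov P B C.
  move=> lA lB lC; rewrite -mulN1r -covZl// -covDl ?LfunZ//.
  by congr cov; apply/funext => w; rewrite mulN1r.
have covB' A B C : A \in Lfun P 2%:E -> B \in Lfun P 2%:E -> C \in Lfun P 2%:E ->
    cov P C (fun w => A w - B w) = cov P C A - cov P C B.
  by move=> lA lB lC; rewrite !(covC _ C) covB.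
rewrite !covB// !covB'// !covDl// !covDr//.
by rewrite ler_norml => h1 h2 h3 h4; apply/andP; split; lra.
Qed.

Lemma dominated_X n h : (1 <= h <= n)%N -> dominated n (X h) (X h).
Proof.
case: h => // h /andP[_ hn].
exists (fun x => tnth x (Ordinal hn)), (fun x => tnth x (Ordinal hn)).
have XE : X h.+1 = (fun x : n.-tuple R => tnth x (Ordinal hn)) \o sample n :> (T -> R).
  by apply/funext => w /=; rewrite tnth_mktuple.
split => //; try exact: measurable_tnth.
by move=> x y xy; rewrite ger0_norm// subr_ge0.
Qed.

Lemma dominated_cst n k : dominated n (fun=> k) (fun=> 0).
Proof.
exists (fun=> k), (fun=> 0); split => //.
by move=> x y _; rewrite !subrr normr0.
Qed.

Lemma dominatedD n U F V G : dominated n U F -> dominated n V G ->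
  dominated n (fun w => U w + V w) (fun w => F w + G w).
Proof.
move=> [u [f [mu mf -> -> uf]]] [v [g [mv mg -> -> vg]]].
exists (fun x => u x + v x), (fun x => f x + g x); split => //;
  try exact: measurable_funD.
move=> x y xy; have := uf x y xy; have := vg x y xy.
by rewrite !ler_norml => /andP[? ?] /andP[? ?]; apply/andP; split; lra.
Qed.

Lemma dominated_sum n (I : Type) (r : seq I) (A : pred I) (U F : I -> T -> R) :
  (forall i, A i -> dominated n (U i) (F i)) ->
  dominated n (fun w => \sum_(i <- r | A i) U i w)
              (fun w => \sum_(i <- r | A i) F i w).
Proof.
move=> UF; elim: r => [|i r IH].
  under eq_fun do rewrite big_nil; under [X in dominated _ _ X]eq_fun do rewrite big_nil.
  exact: dominated_cst.
under eq_fun do rewrite big_cons.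
under [X in dominated _ _ X]eq_fun do rewrite big_cons.
by case: (boolP (A i)) => // Ai; apply: dominatedD => //; exact: UF.
Qed.

Lemma dominated_lipschitz n U F L h : lipschitz_fun L h -> dominated n U F ->
  dominated n (h \o U) (fun w => L * F w).
Proof.
move=> hL [u [f [mu mf -> -> uf]]].
have L0 := lipschitz_ge0 hL.
exists (h \o u), (fun x => L * f x); split => //.
- by apply: measurableT_comp => //; exact: lipschitz_measurable hL.
- exact: measurable_funM.
- move=> x y xy; apply: le_trans (hL _ _) _.
  by rewrite -mulrBr ler_wpM2l// uf.
Qed.

(** |u'v' - uv| <= |u'||v' - v| + |v||u' - u|, and both outer factors are at most
    1. The representing functions need not take values in [0, 1] off the range of
    the sample, so they are first composed with [ramp], which is 1-Lipschitz. *)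
Lemma dominatedM n U F V G :
  (forall w, 0 <= U w <= 1) -> (forall w, 0 <= V w <= 1) ->
  dominated n U F -> dominated n V G ->
  dominated n (fun w => U w * V w) (fun w => F w + G w).
Proof.
move=> U01 V01 [u [f [mu mf UE -> uf]]] [v [g [mv mg VE -> vg]]].
have mc z : measurable_fun setT z ->
    measurable_fun setT (ramp \o z : n.-tuple R -> R).
  move=> mz; apply: measurable_maxr => //; exact: measurable_minr.
exists (fun x => ramp (u x) * ramp (v x)), (fun x => f x + g x).
split.
- by apply: measurable_funM; exact: mc.
- exact: measurable_funD.
- apply/funext => w /=; have := U01 w; have := V01 w; rewrite UE VE => v01 u01.
  by rewrite !ramp_id.
- by [].
- move=> x y xy; have := uf x y xy; have := vg x y xy.
  have := ramp_dist (u y) (u x); have := ramp_dist (v y) (v x).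
  have /andP[] := ramp_itv (u y); have /andP[] := ramp_itv (v x).
  move: (ramp (u x)) (ramp (u y)) (ramp (v x))
    (ramp (v y)) => a b c e.
  move=> c0 c1 b0 b1 h1 h2 h3 h4.
  have -> : b * e - a * c = b * (e - c) + c * (b - a) by ring.
  apply: le_trans (ler_normD _ _) _; rewrite !normrM (ger0_norm b0) (ger0_norm c0).
  have := ler_piMl (normr_ge0 (e - c)) b1.
  have := ler_piMl (normr_ge0 (b - a)) c1; lra.
Qed.

Lemma dominated_prod n q (U F : 'I_q -> T -> R) :
  (forall i w, 0 <= U i w <= 1) -> (forall i, dominated n (U i) (F i)) ->
  dominated n (fun w => \prod_i U i w) (fun w => \sum_i F i w).
Proof.
elim: q U F => [|q IH] U F U01 UF.
  under eq_fun do rewrite big_ord0; under [X in dominated _ _ X]eq_fun do rewrite big_ord0.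
  exact: dominated_cst.
under eq_fun do rewrite big_ord_recl.
under [X in dominated _ _ X]eq_fun do rewrite big_ord_recl.
apply: dominatedM => //; last exact: IH.
move=> w; rewrite prodr_ge0/=; last by move=> i _; case/andP: (U01 (lift ord0 i) w).
by rewrite prodr_ile1// => i _; exact: U01.
Qed.

End association.

(** * Approximate Stein identity for sums of associated blocks *)
Section stein_decoupling.
Context d (T : measurableType d) (R : realType) (P : probability T R).
Variable X : nat -> {RV P >-> R}.
Hypothesis X_assoc : associated X.

Definition tail_sqr (e x : R) : R := if e <= `|x| then x ^+ 2 else 0.

(** A Lipschitz substitute for the square, which is what the covariance inequality
    can handle; it differs from the square by at most [tail_sqr], the integrand of
    Lindeberg's condition. *)
Definition trunc_sqr (e x : R) : R := Num.min `|x| e ^+ 2.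

Lemma trunc_sqr_lipschitz e : 0 <= e -> lipschitz_fun (2 * e) (trunc_sqr e).
Proof.
move=> e0 x y; rewrite /trunc_sqr.
have mn (z : R) : 0 <= Num.min `|z| e <= e by rewrite le_min normr_ge0 e0 ge_min lexx orbT.
have ml : `|Num.min `|x| e - Num.min `|y| e| <= `|x - y|.
  have := lerB_dist x y; have := lerB_dist y x; rewrite (distrC y).
  have := normr_ge0 (x - y).
  case: (leP `|x| e) => hx; case: (leP `|y| e) => hy h1 h2 h3; rewrite ler_norml;
    apply/andP; split; lra.
have /andP[x0 xe] := mn x; have /andP[y0 ye] := mn y.
move: (Num.min _ _) (Num.min _ _) x0 xe y0 ye ml => a b a0 ae b0 be ab.
rewrite subr_sqr normrM mulrC; apply: ler_pM => //.
by rewrite ger0_norm; lra.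
Qed.

Lemma trunc_sqr_itv e x : 0 <= e -> 0 <= trunc_sqr e x <= e ^+ 2.
Proof.
move=> e0; have : 0 <= Num.min `|x| e <= e by rewrite le_min normr_ge0 e0 ge_min lexx orbT.
move=> /andP[m0 me]; rewrite /trunc_sqr sqr_ge0/=.
by rewrite lerXn2r.
Qed.

Lemma sqr_trunc_tail e x : 0 <= e -> 0 <= x ^+ 2 - trunc_sqr e x <= tail_sqr e x.
Proof.
move=> e0; rewrite /trunc_sqr /tail_sqr; case: (leP e `|x|) => h.
  have ex : e ^+ 2 <= x ^+ 2 by rewrite -(real_normK (num_real x)) lerXn2r ?nnegrE.
  have := sqr_ge0 e; move=> ?; apply/andP; split; lra.
by rewrite real_normK ?num_real// subrr lexx.
Qed.

Lemma tail_sqr_itv e x : 0 <= tail_sqr e x <= x ^+ 2.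
Proof. by rewrite /tail_sqr; case: ifP; rewrite ?sqr_ge0 ?lexx. Qed.

Lemma measurable_tail_sqr e : measurable_fun setT (tail_sqr e).
Proof.
by apply: measurable_fun_ifT => //; exact: measurable_fun_ler.
Qed.

Lemma Lfun1_tail_sqr e (xi : T -> R) : xi \in Lfun P 2%:E ->
  (tail_sqr e \o xi) \in Lfun P 1.
Proof.
move=> lxi; apply: Lfun1_dominated (Lfun2_sqr lxi) _.
  by apply: measurableT_comp; [exact: measurable_tail_sqr|exact: Lfun_measurable lxi].
by move=> w /=; have /andP[h1 h2] := tail_sqr_itv e (xi w); rewrite ger0_norm.
Qed.

(** On the event |xi| >= e one has |xi| <= xi^2 / e. *)
Lemma mean_norm_tail e (xi : T -> R) : 0 < e -> xi \in Lfun P 2%:E ->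
  mean P (fun w => `|xi w|) <= e + mean P (tail_sqr e \o xi) / e.
Proof.
move=> e0 lxi.
have lt := Lfun1_tail_sqr e lxi.
rewrite -[e in e + _](mean_cst P) mulrC -meanZ// -meanD//; first last.
- exact: LfunZ.
- exact: (Lfun_cst P e 1).
apply: mean_le.
- by apply: Lfun_norm; exact: Lfun21.
- by apply: LfunD => //; [exact: (Lfun_cst P e 1)|exact: LfunZ].
move=> w /=; rewrite /tail_sqr; case: (leP e) => h; last by lra.
rewrite -(real_normK (num_real (xi w))) expr2 mulrA ler_wpDl//; first exact: ltW.
by rewrite ler_peMl// mulrC ler_pdivlMr// mul1r.
Qed.

Variables (f f' : R -> R) (B : R).
Hypothesis f_bounded : forall x, `|f x| <= B.
Hypothesis f'_bounded : forall x, `|f' x| <= B.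
Hypothesis f_lip : lipschitz_fun B f.
Hypothesis f'_lip : lipschitz_fun B f'.
Hypothesis f_taylor : forall x y, `|f y - f x - (y - x) * f' x| <= B * (y - x) ^+ 2.

(** One summand [xi] of the sum, [tau] being the sum of the others. Four errors are
    made in passing from E[xi f(tau + xi)] to Var(xi) E[f'(tau + xi)]: the
    correlation of [xi] with [f(tau)], the Taylor remainder, the correlation of
    the truncated [xi^2] with [f'(tau)], and the shift from [tau] back to
    [tau + xi]; truncating [xi^2] adds tails. *)
Lemma stein_one n e (xi tau : T -> R) : 0 < e ->
  xi \in Lfun P 2%:E -> tau \in Lfun P 2%:E ->
  dominated X n xi xi -> dominated X n tau tau -> mean P xi = 0 ->
  `|cov P xi xi * mean P (fun w => f' (tau w + xi w)) -
    mean P (fun w => xi w * f (tau w + xi w))| <=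
  B * ((1 + 2 * e) * cov P xi tau + e * cov P xi xi +
       4 * mean P (tail_sqr e \o xi) +
       cov P xi xi * (e + mean P (tail_sqr e \o xi) / e)).
Proof.
move=> e0 lxi ltau dxi dtau xi0; set la := mean P (tail_sqr e \o xi).
have e0' := ltW e0.
have B0 : 0 <= B by apply: le_trans (f_bounded 0).
have l21 : (1 <= 2%:E :> \bar R)%E by rewrite lee_fin ler1n.
have mxi := Lfun_measurable lxi; have mtau := Lfun_measurable ltau.
have mf : measurable_fun setT f := lipschitz_measurable f_lip.
have mf' : measurable_fun setT f' := lipschitz_measurable f'_lip.
have mtx : measurable_fun setT (fun w => tau w + xi w) by exact: measurable_funD.
have lf (u : T -> R) : measurable_fun setT u -> (fun w => f (u w)) \in Lfun P 2%:E.
  move=> mu; apply: (@Lfun2_bounded _ _ _ _ _ B) => // w.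
  exact: (measurableT_comp mf mu).
have lf' (u : T -> R) : measurable_fun setT u -> (fun w => f' (u w)) \in Lfun P 2%:E.
  move=> mu; apply: (@Lfun2_bounded _ _ _ _ _ B) => // w.
  exact: (measurableT_comp mf' mu).
have lq : (fun w => trunc_sqr e (xi w)) \in Lfun P 2%:E.
  apply: (@Lfun2_bounded _ _ _ _ _ (e ^+ 2)).
    exact: (measurableT_comp (lipschitz_measurable (trunc_sqr_lipschitz e0')) mxi).
  by move=> w; have /andP[? ?] := trunc_sqr_itv (xi w) e0'; rewrite ger0_norm.
have lt : (fun w => tail_sqr e (xi w)) \in Lfun P 1 := Lfun1_tail_sqr e lxi.
have lx2 := Lfun2_sqr lxi.
have v0 : 0 <= cov P xi xi.
  by rewrite cov_centered//; apply: mean_ge0 => w; rewrite -expr2 sqr_ge0.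
have vE : cov P xi xi = mean P (fun w => xi w ^+ 2) by rewrite cov_centered.
have lx2f' : (fun w => xi w ^+ 2 * f' (tau w)) \in Lfun P 1.
  apply: Lfun1_dominated (LfunZ B _ lx2) _ => //.
    by apply: measurable_funM; [exact: measurable_funX|exact: (measurableT_comp mf' mtau)].
  by move=> w; rewrite normrM mulrC (ger0_norm (sqr_ge0 _)) ler_wpM2r ?sqr_ge0.
have h1 : `|mean P (fun w => xi w * f (tau w))| <= B * cov P xi tau.
  rewrite -cov_centered//.
  have := dominated_cov X_assoc lxi lxi (lf _ mtau) (LfunZ B l21 ltau) dxi
    (dominated_lipschitz f_lip dtau).
  by rewrite covZr.
have h2 : `|mean P (fun w => xi w * f (tau w + xi w)) -
    (mean P (fun w => xi w * f (tau w)) + mean P (fun w => xi w ^+ 2 * f' (tau w)))|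
    <= B * (e * cov P xi xi + 2 * la).
  rewrite -meanD//; last by apply: Lfun2_mul => //; exact: lf.
  rewrite vE -(meanZ e lx2) -(meanZ 2 lt) -meanD; [|exact: LfunZ..].
  rewrite -meanZ; last by apply: LfunD => //; exact: LfunZ.
  apply: mean_normB_le.
  - by apply: Lfun2_mul => //; exact: lf.
  - by apply: LfunD => //; apply: Lfun2_mul => //; exact: lf.
  - by apply: LfunZ => //; apply: LfunD => //; exact: LfunZ.
  - move=> w; move: (xi w) (tau w) => x t.
    have -> : x * f (t + x) - (x * f t + x ^+ 2 * f' t) =
      x * (f (t + x) - f t - x * f' t) by ring.
    have tx : t + x - t = x by ring.
    have := f_taylor t (t + x); rewrite tx => ft.
    have := f_lip (t + x) t; rewrite tx => fl.
    (* the Taylor remainder is quadratic, which is used for |x| < e, and at most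
       linear, which is used on the tail *)
    have fl2 : `|f (t + x) - f t - x * f' t| <= 2 * B * `|x|.
      apply: le_trans (ler_normB _ _) _; rewrite normrM [`|x| * _]mulrC.
      have := ler_wpM2r (normr_ge0 x) (f'_bounded t); lra.
    rewrite normrM /tail_sqr; case: (leP e `|x|) => h.
      have := ler_wpM2l (normr_ge0 x) fl2.
      have := mulr_ge0 B0 (mulr_ge0 e0' (sqr_ge0 x)).
      have -> : `|x| * (2 * B * `|x|) = 2 * B * x ^+ 2.
        by rewrite -(real_normK (num_real x)); ring.
      lra.
    have := ler_wpM2l (normr_ge0 x) ft.
    have := ler_wpM2r (mulr_ge0 B0 (sqr_ge0 x)) (ltW h); lra.
have h3 : `|mean P (fun w => xi w ^+ 2 * f' (tau w)) -
    mean P (fun w => trunc_sqr e (xi w) * f' (tau w))| <= B * la.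
  rewrite -(meanZ B lt); apply: mean_normB_le => //.
  - by apply: Lfun2_mul => //; exact: lf'.
  - exact: LfunZ.
  - move=> w; rewrite -mulrBl normrM.
    have /andP[? ?] := sqr_trunc_tail (xi w) e0'.
    by rewrite ger0_norm// [leRHS]mulrC ler_pM.
have h4 : `|mean P (fun w => trunc_sqr e (xi w) * f' (tau w)) -
    mean P (fun w => trunc_sqr e (xi w)) * mean P (fun w => f' (tau w))|
    <= 2 * e * (B * cov P xi tau).
  have := dominated_cov X_assoc lq (LfunZ (2 * e) l21 lxi) (lf' _ mtau) (LfunZ B l21 ltau)
    (dominated_lipschitz (trunc_sqr_lipschitz e0') dxi) (dominated_lipschitz f'_lip dtau).
  by rewrite covZl ?LfunZ// covZr.
have h5 : `|mean P (fun w => f' (tau w))| <= B.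
  apply: (@le_trans _ _ (mean P (fun=> B))); last by rewrite mean_cst.
  apply: mean_norm_le => //.
    by apply: Lfun21; exact: lf'.
  exact: (Lfun_cst P B 1).
have h6 : 0 <= cov P xi xi - mean P (fun w => trunc_sqr e (xi w)) <= la.
  rewrite vE -(meanB lx2 (Lfun21 lq)); apply/andP; split.
    by apply: mean_ge0 => w; case/andP: (sqr_trunc_tail (xi w) e0').
  apply: mean_le => //; first by apply: LfunB => //; exact: Lfun21.
  by move=> w; case/andP: (sqr_trunc_tail (xi w) e0').
have h7 : `|mean P (fun w => f' (tau w + xi w)) - mean P (fun w => f' (tau w))|
    <= B * (e + la / e).
  apply: (@le_trans _ _ (B * mean P (fun w => `|xi w|))); last first.
    by apply: ler_wpM2l => //; exact: mean_norm_tail.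
  have lnx : (fun w => `|xi w|) \in Lfun P 1 by apply: Lfun_norm; exact: Lfun21.
  rewrite -meanZ//; apply: mean_normB_le.
  - by apply: Lfun21; exact: lf'.
  - by apply: Lfun21; exact: lf'.
  - exact: LfunZ.
  - by move=> w; rewrite (le_trans (f'_lip _ _))//; have -> : tau w + xi w - tau w = xi w by ring.
move: h1 h2 h3 h4 h5 h6 h7 => {vE}.
set a1 := mean P (fun w => f' (tau w + xi w)).
set a2 := mean P (fun w => xi w * f (tau w + xi w)).
set a3 := mean P (fun w => xi w * f (tau w)).
set a4 := mean P (fun w => xi w ^+ 2 * f' (tau w)).
set a5 := mean P (fun w => trunc_sqr e (xi w) * f' (tau w)).
set a6 := mean P (fun w => trunc_sqr e (xi w)).
set a7 := mean P (fun w => f' (tau w)).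
move: (cov P xi xi) v0 (cov P xi tau) => v v0 c h1 h2 h3 h4 h5 /andP[h6 h6'] h7.
have -> : v * a1 - a2 = v * (a1 - a7) + (v - a6) * a7 - (a5 - a6 * a7)
  - (a4 - a5) - (a2 - (a3 + a4)) - a3 by ring.
have g1 : `|v * (a1 - a7)| <= v * (B * (e + la / e)).
  by rewrite normrM ger0_norm// ler_wpM2l.
have g2 : `|(v - a6) * a7| <= la * B by rewrite normrM ger0_norm// ler_pM.
move: g1 g2 h1 h2 h3 h4.
move: (v * (a1 - a7)) ((v - a6) * a7) (a5 - a6 * a7) (a4 - a5)
  (a2 - (a3 + a4)) => z1 z2 z3 z4 z5.
rewrite !ler_norml => /andP[? ?] /andP[? ?] /andP[? ?] /andP[? ?] /andP[? ?] /andP[? ?].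
apply/andP; split; lra.
Qed.

(** The covariances of each summand with the sum of the others add up to
    Var S - V, so the dependence between the summands enters the bound only
    through this global quantity. *)
Lemma stein_sum n e m (xi : 'I_m -> T -> R)
    (S := fun w => \sum_j xi j w)
    (V := \sum_j cov P (xi j) (xi j))
    (La := \sum_j mean P (tail_sqr e \o xi j)) : 0 < e ->
  (forall j, xi j \in Lfun P 2%:E) -> (forall j, dominated X n (xi j) (xi j)) ->
  (forall j, mean P (xi j) = 0) ->
  `|V * mean P (f' \o S) - mean P (fun w => S w * f (S w))| <=
    B * ((1 + 2 * e) * (cov P S S - V) + e * V + 4 * La + V * (e + La / e)).
Proof.
move=> e0 lxi dxi xi0.
have l21 : (1 <= 2%:E :> \bar R)%E by rewrite lee_fin ler1n.
have B0 : 0 <= B by apply: le_trans (f_bounded 0).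
pose tau j w := \sum_(k | k != j) xi k w.
have ltau j : tau j \in Lfun P 2%:E by apply: Lfun_sum.
have lS : S \in Lfun P 2%:E by apply: Lfun_sum.
have dtau j : dominated X n (tau j) (tau j) by exact: dominated_sum.
have SE j w : S w = tau j w + xi j w by rewrite /S (bigD1 j)//= addrC.
have VC : cov P S S - V = \sum_j cov P (xi j) (tau j).
  have -> : cov P S S = \sum_j cov P S (xi j) by exact: cov_sumr.
  rewrite /V -sumrB; apply: eq_bigr => j _.
  rewrite (covC P S); have -> : S = (fun w => tau j w + xi j w) by exact/funext.
  by rewrite covDr// addrK.
have mf : measurable_fun setT f := lipschitz_measurable f_lip.
have mS := Lfun_measurable lS.
have lfS : (fun w => f (S w)) \in Lfun P 2%:E.
  apply: (@Lfun2_bounded _ _ _ _ _ B) => //; exact: (measurableT_comp mf mS).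
have -> : mean P (fun w => S w * f (S w)) = \sum_j mean P (fun w => xi j w * f (S w)).
  rewrite -mean_sum; last by move=> j _; exact: Lfun2_mul.
  by congr mean; apply/funext => w; rewrite mulr_suml.
rewrite {1}/V mulr_suml -sumrB; apply: le_trans (ler_norm_sum _ _ _) _.
pose la j := mean P (tail_sqr e \o xi j).
have la0 j : 0 <= la j by apply: mean_ge0 => w; case/andP: (tail_sqr_itv e (xi j w)).
have v0 j : 0 <= cov P (xi j) (xi j).
  by rewrite cov_centered//; apply: mean_ge0 => w; rewrite -expr2 sqr_ge0.
apply: (@le_trans _ _ (\sum_j B * ((1 + 2 * e) * cov P (xi j) (tau j) +
    e * cov P (xi j) (xi j) + 4 * la j + cov P (xi j) (xi j) * (e + La / e)))).
  apply: ler_sum => j _.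
  have := stein_one e0 (lxi j) (ltau j) (dxi j) (dtau j) (xi0 j).
  have -> : (fun w => f' (tau j w + xi j w)) = f' \o S.
    by apply/funext => w /=; rewrite (SE j).
  have -> : (fun w => xi j w * f (tau j w + xi j w)) = (fun w => xi j w * f (S w)).
    by apply/funext => w /=; rewrite (SE j).
  move=> /le_trans; apply; apply: ler_wpM2l => //; rewrite lerD2l ler_wpM2l// lerD2l.
  rewrite ler_pM2r ?invr_gt0// /La (bigD1 j)//= lerDl.
  by apply: sumr_ge0 => k _; exact: la0.
have sumE (b k : R) (c v l : 'I_m -> R) :
    \sum_j ((1 + 2 * b) * c j + b * v j + 4 * l j + v j * k) =
    (1 + 2 * b) * (\sum_j c j) + b * (\sum_j v j) + 4 * (\sum_j l j) +
    (\sum_j v j) * k.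
  by rewrite !big_split/= -!mulr_sumr -mulr_suml.
by rewrite VC -mulr_sumr sumE.
Qed.

(** For fixed [e] the bound of [stein_sum] tends to 2 B s2 e, which is as small as
    one likes. *)
Lemma stein_limit (s2 : R) (N m : nat -> nat) (xi : forall n, 'I_(m n) -> T -> R) :
  (forall n j, xi n j \in Lfun P 2%:E) ->
  (forall n j, dominated X (N n) (xi n j) (xi n j)) ->
  (forall n j, mean P (xi n j) = 0) ->
  \sum_j cov P (xi n j) (xi n j) @[n --> \oo] --> s2 ->
  cov P (fun w => \sum_j xi n j w) (fun w => \sum_j xi n j w) @[n --> \oo] --> s2 ->
  (forall e, 0 < e ->
    \sum_j mean P (tail_sqr e \o xi n j) @[n --> \oo] --> (0 : R)) ->
  mean P (fun w => s2 * f' (\sum_j xi n j w) -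
    (\sum_j xi n j w) * f (\sum_j xi n j w)) @[n --> \oo] --> (0 : R).
Proof.
move=> lxi dxi xi0 Vs Ss Las.
have l21 : (1 <= 2%:E :> \bar R)%E by rewrite lee_fin ler1n.
have B0 : 0 <= B by apply: le_trans (f_bounded 0).
have mf : measurable_fun setT f := lipschitz_measurable f_lip.
have mf' : measurable_fun setT f' := lipschitz_measurable f'_lip.
have s20 : 0 <= s2.
  apply: (cvgr_to_ge Vs); apply: nearW => n; apply: sumr_ge0 => j _.
  by rewrite cov_centered//; apply: mean_ge0 => w; rewrite -expr2 sqr_ge0.
apply/cvgrPdist_le => de de0.
(* 2 B s2 e < de; the added 1 covers the case B s2 = 0 *)
pose e := de / (2 * B * s2 + 1).
have e0 : 0 < e by rewrite divr_gt0// ltr_wpDl// !mulr_ge0.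
pose V n := \sum_j cov P (xi n j) (xi n j).
pose S n w := \sum_j xi n j w.
pose La n := \sum_j mean P (tail_sqr e \o xi n j).
have bc : `|s2 - V n| * B + B * ((1 + 2 * e) * (cov P (S n) (S n) - V n) + e * V n +
    4 * La n + V n * (e + La n / e)) @[n --> \oo] -->
    `|s2 - s2| * B + B * ((1 + 2 * e) * (s2 - s2) + e * s2 + 4 * 0 + s2 * (e + 0 / e)).
  apply: cvgD; first by apply: cvgMl; apply: cvg_norm; apply: cvgB => //; exact: cvg_cst.
  apply: cvgMr; apply: cvgD; last apply: cvgM => //.
    apply: cvgD; first apply: cvgD.
    - by apply: cvgMr; exact: cvgB.
    - exact: cvgMr.
    - by apply: cvgMr; exact: Las.
  by apply: cvgD; [exact: cvg_cst|apply: cvgMl; exact: Las].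
have : \forall n \near \oo, `|s2 - V n| * B + B * ((1 + 2 * e) *
    (cov P (S n) (S n) - V n) + e * V n + 4 * La n + V n * (e + La n / e)) <= de.
  apply: (cvgr_le _ bc).
  have -> : `|s2 - s2| * B + B * ((1 + 2 * e) * (s2 - s2) + e * s2 + 4 * 0 +
    s2 * (e + 0 / e)) = 2 * B * s2 * e by rewrite subrr normr0; ring.
  have k0 : 0 <= 2 * B * s2 by rewrite !mulr_ge0.
  rewrite /e; move: (2 * B * s2) k0 => k k0.
  by rewrite mulrA ltr_pdivrMr ?ltr_wpDl// mulrDr mulr1 mulrC ltrDl.
apply: filterS => n hn; rewrite sub0r normrN; apply: le_trans hn.
have lS : S n \in Lfun P 2%:E by apply: Lfun_sum.
have mS := Lfun_measurable lS.
have lfS : (fun w => f (S n w)) \in Lfun P 2%:E.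
  apply: (@Lfun2_bounded _ _ _ _ _ B) => //; exact: (measurableT_comp mf mS).
have lf'S : (f' \o S n) \in Lfun P 1.
  apply: (@Lfun1_bounded _ _ _ _ _ B).
    exact: (measurableT_comp mf' mS).
  by move=> w; exact: f'_bounded.
rewrite meanB; [|exact: (LfunZ s2 _ lf'S)|exact: Lfun2_mul].
rewrite (meanZ s2 lf'S).
have -> : s2 * mean P (f' \o S n) - mean P (fun w => S n w * f (S n w)) =
  (s2 - V n) * mean P (f' \o S n) +
  (V n * mean P (f' \o S n) - mean P (fun w => S n w * f (S n w))) by ring.
apply: le_trans (ler_normD _ _) _; apply: lerD; last exact: stein_sum.
rewrite normrM ler_wpM2l//.
apply: (@le_trans _ _ (mean P (fun=> B))); last by rewrite mean_cst.
apply: mean_norm_le => //; first exact: (Lfun_cst P B 1).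
by move=> w; exact: f'_bounded.
Qed.

End stein_decoupling.

(** * Stein's equation with compactly supported data *)
Section calculus.
Context {R : realType}.
Implicit Types (f g : R -> R).

Lemma mean_value f f' : (forall x : R, is_derive x 1 f (f' x)) ->
  forall x y, exists2 c, `|c - x| <= `|y - x| & f y - f x = f' c * (y - x).
Proof.
move=> df x y.
have cf a b : {within `[a, b], continuous f}.
  apply: continuous_subspaceT => z; apply: differentiable_continuous.
  by apply/derivable1_diffP; apply: (@ex_derive _ _ _ _ _ _ _ (df z)).
have [xy|yx] := leP x y.
  have [c cxy ->] := MVT_segment xy (fun z _ => df z) (cf _ _).
  exists c => //; move: cxy; rewrite in_itv/= => /andP[h1 h2].
  by rewrite !ger0_norm ?subr_ge0// lerB.
have [c cxy E] := MVT_segment (ltW yx) (fun z _ => df z) (cf _ _).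
exists c; last by rewrite -opprB E -mulrN opprB.
move: cxy; rewrite in_itv/= => /andP[h1 h2].
rewrite distrC (distrC y) !ger0_norm ?subr_ge0 ?(ltW yx)//; exact: lerB.
Qed.

Lemma derive_lipschitz f f' L : (forall x : R, is_derive x 1 f (f' x)) ->
  (forall x, `|f' x| <= L) -> lipschitz_fun L f.
Proof.
move=> df f'L x y; have [c _ ->] := mean_value df y x.
by rewrite normrM ler_wpM2r.
Qed.

Lemma derive_taylor f f' L : 0 <= L -> (forall x : R, is_derive x 1 f (f' x)) ->
  lipschitz_fun L f' ->
  forall x y, `|f y - f x - (y - x) * f' x| <= L * (y - x) ^+ 2.
Proof.
move=> L0 df f'L x y; have [c cx ->] := mean_value df x y.
rewrite mulrC -mulrBr normrM -[(y - x) ^+ 2]real_normK ?num_real// expr2 mulrCA.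
rewrite ler_wpM2l//; apply: le_trans (f'L _ _) _; exact: ler_wpM2l.
Qed.

(** Such an [f] is bounded by its maximum over [-K, K]. *)
Lemma continuous_bounded f K : continuous f -> (forall x, K <= `|x| -> f x = 0) ->
  exists2 M, 0 <= M & forall x, `|f x| <= M.
Proof.
move=> cf f0; have [K0|K0] := leP K 0.
  by exists 0 => // x; rewrite f0 ?normr0// (le_trans K0).
have KK : - K <= K by lra.
have cnf : {within `[- K, K], continuous (fun x => `|f x|)}.
  by apply: continuous_subspaceT => x; apply: continuous_comp; [exact: cf|exact: norm_continuous].
have [c _ cM] := EVT_max KK cnf.
exists `|f c| => // x; have [Kx|xK] := leP K `|x|; first by rewrite f0// normr0.
by apply: cM; rewrite in_itv/= -ler_norml ltW.
Qed.

End calculus.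

Section stein_equation.
Context {R : realType}.
Notation mu := (@lebesgue_measure R).
Variables (s L K : R) (h : R -> R).
Hypotheses (s0 : 0 < s) (K0 : 0 < K) (hL : lipschitz_fun L h).
Hypothesis hK : forall x, K <= `|x| -> h x = 0.

Let g x := h x * normal_pdf 0 s x.

Let ch : continuous h := lipschitz_continuous hL.

Let cg : continuous g.
Proof.
move=> x; apply: continuousM; first exact: ch.
by apply: continuous_normal_pdf; rewrite gt_eqF.
Qed.

Let ig : mu.-integrable setT (EFin \o g).
Proof.
have [M M0 hM] := continuous_bounded ch hK.
have := integrableZl measurableT M (integrable_normal_pdf 0 s).
apply: le_integrable => //.
  by apply/measurable_EFinP; exact: continuous_measurable_fun.
move=> x _ /=; rewrite lee_fin normrM [leRHS]normrM.
by rewrite ler_wpM2r// (ger0_norm M0).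
Qed.

Let F x := \int[mu]_(t in `]-oo, x]) g t.

Let dF (x : R) : is_derive x 1 F (g x).
Proof.
have xx : x < x + 1 by rewrite ltrDl.
have iu : mu.-integrable `]-oo, x + 1] (EFin \o g).
  by apply: integrableS ig.
have [] := @continuous_FTC1 _ g -oo%O x _ xx iu (ltNyr _) (@cg x).
by move=> dx E; rewrite -E derive1E; exact: DeriveDef.
Qed.

Let hN (t : R) : t <= - K -> h t = 0.
Proof. by move=> tK; have K1 := K0; rewrite hK// ler0_norm; lra. Qed.

Let hP (t : R) : K <= t -> h t = 0.
Proof. by move=> tK; have K1 := K0; rewrite hK// ger0_norm; lra. Qed.

Let FN x : x <= - K -> F x = 0.
Proof.
move=> xK; rewrite /F (@eq_Rintegral _ _ _ _ _ (fun=> 0)).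
  by rewrite Rintegral_cst// mul0r.
move=> t; rewrite inE/= in_itv/= => tx; rewrite /g hN ?mul0r//.
exact: le_trans xK.
Qed.

Hypothesis h_centered : \int[mu]_t g t = 0.

(** The hypothesis that [h] has Gaussian mean 0 makes the primitive vanish to the
    right of the support as well. *)
Let FP x : K <= x -> F x = 0.
Proof.
move=> Kx; rewrite -h_centered /F Rintegral_mkcond; apply: eq_Rintegral => t _.
rewrite /patch; case: ifPn => //; rewrite notin_setE/= in_itv/= => /negP.
by rewrite -ltNge => xt; rewrite /g hP ?mul0r//; exact: le_trans (ltW xt).
Qed.

(** The solution of s^2 f' - x f = h by the integrating factor
    exp (- x^2 / (2 s^2)), which is the normal density up to its peak value. *)
Let f x := F x * expR (x ^+ 2 / (s ^+ 2 *+ 2)) / (normal_peak s * s ^+ 2).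
Let f' x := (h x + x * f x) / s ^+ 2.

Let p0 : 0 < normal_peak s. Proof. by apply: normal_peak_gt0; rewrite gt_eqF. Qed.

Let df (x : R) : is_derive x 1 f (f' x).
Proof.
have s2 : s ^+ 2 != 0 by rewrite expf_neq0// gt_eqF.
pose q : R -> R := (s ^+ 2 *+ 2)^-1 \*: (@id R ^+ 2).
have dq : is_derive x 1 q (x / s ^+ 2).
  apply: is_derive_eq; rewrite /GRing.scale/=.
  rewrite mulr1 expr1 mulr2n; field.
  by rewrite gt_eqF//= -mulr2n mulrn_eq0.
have dE : is_derive x 1 (expR \o q) (x / s ^+ 2 * expR (q x)).
  by rewrite mulrC; exact: is_derive1_comp.
have qE y : q y = y ^+ 2 / (s ^+ 2 *+ 2) by rewrite /q/= /GRing.scale/= mulrC.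
have Ep : expR (q x) * normal_pdf 0 s x = normal_peak s.
  rewrite /normal_pdf gt_eqF// mulrCA /normal_fun -expRD qE subr0.
  by rewrite mulNr subrr expR0 mulr1.
have dFE : is_derive x 1 ((normal_peak s * s ^+ 2)^-1 \*: (F * (expR \o q))) (f' x).
  have dFx := dF x; apply: is_derive_eq; rewrite /GRing.scale/= /f' /f.
  rewrite [expR (q x) * g x]mulrCA Ep qE; field.
  by rewrite !gt_eqF.
rewrite (_ : f = (normal_peak s * s ^+ 2)^-1 \*: (F * (expR \o q)))//.
by apply/funext => y; rewrite /f -qE mulrC.
Qed.

Let cf : continuous f.
Proof.
move=> z; apply: differentiable_continuous.
by apply/derivable1_diffP; apply: (@ex_derive _ _ _ _ _ _ _ (df z)).
Qed.

Let fK x : K <= `|x| -> f x = 0.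
Proof.
rewrite ler_normr orbC =>  /orP[xK|xK]; rewrite /f; [rewrite FN|rewrite FP]; rewrite ?mul0r//.
by rewrite lerNr.
Qed.

(** A single constant bounds the solution, its derivative and the Lipschitz
    constants of both; it exists because the solution vanishes outside [-K, K].
    For the derivative (h + x f) / s^2 the Lipschitz bound comes from the bounded
    derivative of x f. *)
Lemma stein_equation : exists u u' : R -> R, exists B : R,
  [/\ (forall x, `|u x| <= B) /\ (forall x, `|u' x| <= B),
      lipschitz_fun B u /\ lipschitz_fun B u',
      (forall x y, `|u y - u x - (y - x) * u' x| <= B * (y - x) ^+ 2) &
      forall x, s ^+ 2 * u' x - x * u x = h x].
Proof.
have s2 : 0 < s ^+ 2 by rewrite exprn_gt0.
have cf' : continuous f'.
  move=> x; apply: cvgMl; apply: cvgD; first exact: ch.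
  by apply: cvgM; [exact: cvg_id|exact: cf].
have f'K x : K <= `|x| -> f' x = 0.
  by move=> Kx; rewrite /f' hK// fK// mulr0 addr0 mul0r.
have [M M0 fM] := continuous_bounded cf fK.
have [M' M'0 fM'] := continuous_bounded cf' f'K.
pose B := M + M' + (L + (M + K * M')) / s ^+ 2.
have L0 := lipschitz_ge0 hL.
have B0 : 0 <= (L + (M + K * M')) / s ^+ 2.
  have kM : 0 <= K * M' by rewrite mulr_ge0// ltW.
  by apply: divr_ge0; [lra|exact: ltW].
have mono (u : R -> R) (b b' : R) : b <= b' -> lipschitz_fun b u -> lipschitz_fun b' u.
  by move=> bb ub x y; apply: le_trans (ub x y) _; exact: ler_wpM2r.
have lf' : lipschitz_fun ((L + (M + K * M')) / s ^+ 2) f'.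
  have dxf (x : R) : is_derive x 1 (fun x => x * f x) (f x + x * f' x).
    have -> : (fun x => x * f x) = @id R * f by [].
    have dx := df x; apply: is_derive_eq; rewrite /GRing.scale/=; ring.
  have lxf : lipschitz_fun (M + K * M') (fun x => x * f x).
    apply: (derive_lipschitz dxf) => x.
    have [Kx|xK] := leP K `|x|.
      by rewrite fK// f'K// mulr0 addr0 normr0 addr_ge0// mulr_ge0// ltW.
    apply: le_trans (ler_normD _ _) _; rewrite lerD// normrM ler_pM//; exact: ltW.
  move=> x y; rewrite /f' -mulrBl normrM.
  have is2 : 0 < (s ^+ 2)^-1 by rewrite invr_gt0.
  rewrite (gtr0_norm is2) [leRHS]mulrAC ler_pM2r//.
  have -> : h x + x * f x - (h y + y * f y) = (h x - h y) + (x * f x - y * f y) by ring.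
  by rewrite mulrDl (le_trans (ler_normD _ _))// lerD.
exists f, f', B; split.
- split=> x; [apply: le_trans (fM x) _|apply: le_trans (fM' x) _]; rewrite /B; lra.
- split; last by apply: mono lf'; rewrite /B; lra.
  by apply: (mono _ M'); [rewrite /B; lra|exact: derive_lipschitz df fM'].
- by apply: (derive_taylor _ df); [rewrite /B; lra|apply: mono lf'; rewrite /B; lra].
- by move=> x; rewrite /f' mulrC divfK ?gt_eqF// addrK.
Qed.

End stein_equation.

(** * Stein's identity characterizes the normal limit *)
Section normal_integral.
Context {R : realType}.
Notation mu := (@lebesgue_measure R).

(** The density of a normal law is a Radon-Nikodym derivative of it, hence equal to
    the derivative chosen by the change of variables formula almost everywhere. *)
Lemma mean_normal_prob (m s : R) (f : R -> R) C : measurable_fun setT f ->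
  (forall x, `|f x| <= C) ->
  mean (normal_prob m s) f = \int[mu]_x (f x * normal_pdf m s x).
Proof.
move=> mf fC; rewrite /mean /Rintegral; congr fine.
have lf := Lfun1_bounded (normal_prob m s) mf fC.
have inf : (normal_prob m s).-integrable setT (EFin \o f) by exact/Lfun1_integrable.
rewrite -(Radon_Nikodym_change_of_variables (normal_prob_dominates m s) measurableT inf).
apply: ae_eq_integral => //.
- apply: emeasurable_funM => //; first exact/measurable_EFinP.
  apply: (measurable_int mu).
  by apply: Radon_Nikodym_integrable; exact: normal_prob_dominates.
- apply/measurable_EFinP; apply: measurable_funM => //.
  exact: measurable_normal_pdf.
- under [X in ae_eq _ _ _ X]eq_fun do rewrite EFinM.
  apply: ae_eqe_mul2l => /=.
  rewrite Radon_NikodymE//=; first exact: normal_prob_dominates.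
  move=> abmu; case: cid => /= g [g1 g2 g3].
  apply: integral_ae_eq => //=.
  + by apply/measurable_EFinP; exact: measurable_normal_pdf.
  + by move=> E ET mE; rewrite -g3.
Qed.

End normal_integral.

Section plateau.
Context {R : realType}.
Implicit Types (K x : R).

(** A cutoff equal to 1 on [-K, K] and to 0 outside [-2 K, 2 K]. *)
Definition plateau K x : R := ramp (2 - `|x| / K).

Lemma plateau_itv K x : 0 <= plateau K x <= 1.
Proof. exact: ramp_itv. Qed.

Lemma plateau1 K x : 0 < K -> `|x| <= K -> plateau K x = 1.
Proof.
move=> K0 xK; have xK1 : `|x| / K <= 1 by rewrite ler_pdivrMr// mul1r.
by apply: ramp_ge1; lra.
Qed.

Lemma plateau0 K x : 0 < K -> 2 * K <= `|x| -> plateau K x = 0.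
Proof.
move=> K0 xK; have xK1 : 2 <= `|x| / K by rewrite ler_pdivlMr.
by apply: ramp_le0; lra.
Qed.

Lemma plateau_lipschitz K : 0 < K -> lipschitz_fun K^-1 (plateau K).
Proof.
move=> K0 x y; apply: le_trans (ramp_dist _ _) _.
have iK : 0 <= K^-1 by rewrite invr_ge0 ltW.
rewrite opprB addrC addrA subrK -mulrBl normrM mulrC (ger0_norm iK) ler_wpM2l//.
by rewrite distrC ler_dist_dist.
Qed.

Lemma lipschitzB (L M : R) (f g : R -> R) : lipschitz_fun L f -> lipschitz_fun M g ->
  lipschitz_fun (L + M) (fun x => f x - g x).
Proof.
move=> fL gM x y.
have -> : f x - g x - (f y - g y) = (f x - f y) - (g x - g y) by ring.
by rewrite (le_trans (ler_normB _ _))// mulrDl lerD.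
Qed.

Lemma lipschitzZ (L k : R) (f : R -> R) : lipschitz_fun L f ->
  lipschitz_fun (`|k| * L) (fun x => k * f x).
Proof. by move=> fL x y; rewrite -mulrBr normrM -mulrA ler_wpM2l. Qed.

End plateau.

Section stein_characterization.
Context d (T : measurableType d) (R : realType) (P : probability T R).
Variables (S : nat -> T -> R) (s : R).
Hypothesis s0 : 0 < s.
Hypothesis lS : forall n, S n \in Lfun P 2%:E.
Hypothesis S_var : mean P (fun w => S n w ^+ 2) @[n --> \oo] --> s ^+ 2.
Hypothesis S_stein : forall (f f' : R -> R) (B : R),
  (forall x, `|f x| <= B) -> (forall x, `|f' x| <= B) ->
  lipschitz_fun B f -> lipschitz_fun B f' ->
  (forall x y, `|f y - f x - (y - x) * f' x| <= B * (y - x) ^+ 2) ->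
  mean P (fun w => s ^+ 2 * f' (S n w) - S n w * f (S n w)) @[n --> \oo] --> (0 : R).

Let Nl := mean (normal_prob 0 s).

(** When [h] has Gaussian mean 0, Stein's identity for the solution of Stein's
    equation is the claim itself. *)
Let stein_cvg0 (h : R -> R) (L K : R) : 0 < K -> lipschitz_fun L h ->
  (forall x, K <= `|x| -> h x = 0) -> Nl h = 0 ->
  mean P (h \o S n) @[n --> \oo] --> (0 : R).
Proof.
move=> K0 hL hK Nh0.
have [M M0 hM] := continuous_bounded (lipschitz_continuous hL) hK.
have mh := lipschitz_measurable hL.
have h_centered : \int[lebesgue_measure]_t (h t * normal_pdf 0 s t) = 0.
  by rewrite -(mean_normal_prob 0 s mh hM).
have [u [u' [B [[u1 u2] [u3 u4] u5 u6]]]] := stein_equation s0 K0 hL hK h_centered.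
have := S_stein u1 u2 u3 u4 u5; apply: cvg_trans; apply: near_eq_cvg; apply: nearW => n.
by congr mean; apply/funext => w /=; rewrite u6.
Qed.

(** The Gaussian mean of [h] is removed by subtracting a multiple of a wide
    plateau, which preserves compact support, unlike subtracting a constant. The
    price is the mass outside [-k, k], small for the normal law by dominated
    convergence and for [S n] by Chebyshev's inequality. *)
Lemma stein_clt (h : R -> R) (L K : R) : 0 < K -> lipschitz_fun L h ->
  (forall x, K <= `|x| -> h x = 0) ->
  mean P (h \o S n) @[n --> \oo] --> mean (normal_prob 0 s) h.
Proof.
move=> K0 hL hK.
have [M M0 hM] := continuous_bounded (lipschitz_continuous hL) hK.
have mh := lipschitz_measurable hL.
have mS n := Lfun_measurable (lS n).
have mpl (k : R) : 0 < k -> measurable_fun setT (plateau k).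
  by move=> k0; exact: lipschitz_measurable (plateau_lipschitz k0).
have npl (k x : R) : `|plateau k x| <= 1.
  by have /andP[a b] := plateau_itv k x; rewrite ger0_norm.
have plcvg : Nl (plateau n.+1%:R) @[n --> \oo] --> (1 : R).
  suff : Nl (plateau n.+1%:R) @[n --> \oo] --> Nl (fun=> 1) by rewrite /Nl mean_cst.
  have Q := @mean_dominated_cvg _ _ _ (normal_prob 0 s) (fun n => plateau n.+1%:R) (fun=> 1) (fun=> 1).
  apply: Q.
  - by move=> n; exact: mpl.
  - exact: measurable_cst.
  - exact: (Lfun_cst _ 1 1).
  - by move=> n w; exact: npl.
  - move=> w; apply: cvg_near_cst; near=> n; apply: plateau1 => //.
    apply: (@le_trans _ _ n%:R); last by rewrite ler_nat.
    by near: n; exact: nbhs_infty_ger.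
apply/cvgrPdist_le => e e0.
(* eta <= 1/2 keeps the plateau mean away from 0, so that |r| <= 2 |Nl h|; then
   the two masses outside the plateau cost at most 4 |Nl h| eta <= e / 2 *)
pose eta := Num.min (2^-1) (e / (8 * (`|Nl h| + 1))).
have eta0 : 0 < eta.
  by rewrite lt_min invr_gt0 ltr0n/= divr_gt0// mulr_gt0// ltr_wpDl.
have [k [k0 kK kpl kvar]] : exists k : R, [/\ 0 < k, K <= k,
    `|1 - Nl (plateau k)| <= eta & (s ^+ 2 + 1) / k ^+ 2 <= eta].
  have : \forall n \near \oo, [/\ 0 < n.+1%:R :> R, K <= n.+1%:R,
      `|1 - Nl (plateau n.+1%:R)| <= eta & (s ^+ 2 + 1) / n.+1%:R ^+ 2 <= eta].
    near=> n; split => //.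
    - by apply: (@le_trans _ _ n%:R); [near: n; exact: nbhs_infty_ger|rewrite ler_nat].
    - by near: n; move/cvgrPdist_le : plcvg; apply.
    - rewrite ler_pdivrMr ?exprn_gt0// mulrC -ler_pdivrMr//.
      apply: (@le_trans _ _ n%:R); first by near: n; exact: nbhs_infty_ger.
      by rewrite -natrX ler_nat (leq_trans (leqnSn n))// expnS expn1 leq_pmulr.
  by case=> N _ /(_ N (leqnn N)) H; exists N.+1%:R.
have Npl : 2^-1 <= Nl (plateau k).
  have : eta <= 2^-1 by rewrite ge_min lexx.
  move: kpl; rewrite ler_norml => /andP[? ?]; lra.
pose r := Nl h / Nl (plateau k).
have rN : `|r| <= 2 * `|Nl h|.
  rewrite normrM mulrC ler_wpM2r// normrV ?unitfE; last by apply/eqP; lra.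
  rewrite ger0_norm; last lra.
  by rewrite -[2]invrK lef_pV2 ?posrE//; lra.
pose h' x := h x - r * plateau k x.
have h'L := lipschitzB hL (lipschitzZ r (plateau_lipschitz k0)).
have h'0 : mean P (h' \o S n) @[n --> \oo] --> (0 : R).
  apply: (@stein_cvg0 h' _ (2 * k)) h'L _ _.
  - by rewrite mulr_gt0.
  - move=> x kx; rewrite /h' hK ?plateau0//; last lra.
    by rewrite mulr0 subr0.
  - rewrite /Nl /h' meanB; first last.
    + apply: LfunZ => //; apply: (@Lfun1_bounded _ _ _ _ _ 1) => //; exact: mpl.
    + exact: (Lfun1_bounded (normal_prob 0 s) mh hM).
    rewrite meanZ; last by apply: (@Lfun1_bounded _ _ _ _ _ 1) => //; exact: mpl.
    by rewrite /r divfK ?subrr//; apply/eqP; lra.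
near=> n.
have lpl : (plateau k \o S n) \in Lfun P 1.
  apply: (@Lfun1_bounded _ _ _ _ _ 1); first exact: (measurableT_comp (mpl _ k0) (mS n)).
  by move=> w; exact: npl.
have lh : (h \o S n) \in Lfun P 1.
  apply: (@Lfun1_bounded _ _ _ _ _ M); first exact: (measurableT_comp mh (mS n)).
  by move=> w; exact: hM.
have h'E : mean P (h' \o S n) = mean P (h \o S n) - r * mean P (plateau k \o S n).
  by rewrite -(meanZ r lpl) -meanB//; exact: LfunZ.
have plS : `|1 - mean P (plateau k \o S n)| <= eta.
  apply: (@le_trans _ _ (mean P (fun w => (k ^+ 2)^-1 * S n w ^+ 2))).
    rewrite -(mean_cst P 1) -meanB//; last exact: (Lfun_cst P 1 1).
    apply: mean_norm_le.
    - by apply: LfunB => //; exact: (Lfun_cst P 1 1).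
    - by apply: LfunZ => //; exact: Lfun2_sqr.
    - move=> w /=; have /andP[a b] := plateau_itv k (S n w).
      rewrite ger0_norm; last lra.
      have [Sk|Sk] := leP `|S n w| k.
        by rewrite plateau1// subrr mulr_ge0 ?sqr_ge0// invr_ge0 sqr_ge0.
      apply: (@le_trans _ _ 1); first lra.
      rewrite mulrC ler_pdivlMr ?exprn_gt0// mul1r -(real_normK (num_real (S n w))).
      by rewrite lerXn2r ?nnegrE// ltW.
  rewrite meanZ ?Lfun2_sqr// mulrC; apply: le_trans kvar.
  rewrite ler_pM2r ?invr_gt0 ?exprn_gt0//.
  near: n; apply: (cvgr_le _ S_var); lra.
have h'e : `|mean P (h' \o S n)| <= e / 2.
  near: n; have e2 : 0 < e / 2 by rewrite divr_gt0.
  move/cvgrPdist_le : h'0 => /(_ _ e2); apply: filterS => n.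
  by rewrite sub0r normrN.
have -> : Nl h - mean P (h \o S n) = r * (Nl (plateau k) - mean P (plateau k \o S n))
    - mean P (h' \o S n).
  rewrite h'E mulrBr /r divfK; first by ring.
  by apply/eqP; lra.
apply: le_trans (ler_normB _ _) _; rewrite normrM.
have b1 : `|Nl (plateau k) - mean P (plateau k \o S n)| <= 2 * eta.
  have -> : Nl (plateau k) - mean P (plateau k \o S n) =
    (1 - mean P (plateau k \o S n)) - (1 - Nl (plateau k)) by ring.
  by rewrite (le_trans (ler_normB _ _))// mulr2n mulrDl mul1r lerD.
have b2 : eta * (8 * (`|Nl h| + 1)) <= e.
  by rewrite -ler_pdivlMr ?mulr_gt0 ?ltr_wpDl// ge_min lexx orbT.
have := ler_pM (normr_ge0 _) (normr_ge0 _) rN b1.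
have := mulr_ge0 (ltW eta0) (normr_ge0 (Nl h)).
nra.
Unshelve. all: by end_near. Qed.

End stein_characterization.

(** * Central limit theorem over one window *)
Lemma cvg_near_eq {R : realType} (u v : nat -> R) (a : R) :
  (\forall n \near \oo, v n = u n) -> u n @[n --> \oo] --> a ->
  v n @[n --> \oo] --> a.
Proof.
move=> uv ua; apply: cvg_trans ua; apply: near_eq_cvg.
by move: uv; apply: filterS => n ->.
Qed.

Section mean_square.
Context d (T : measurableType d) (R : realType) (P : probability T R).

(** From [mean_norm_tail], a Lindeberg tail being at most the second moment. *)
Lemma mean_norm_cvg0 (U : nat -> T -> R) : (forall n, U n \in Lfun P 2%:E) ->
  mean P (fun w => U n w ^+ 2) @[n --> \oo] --> (0 : R) ->
  mean P (fun w => `|U n w|) @[n --> \oo] --> (0 : R).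
Proof.
move=> lU U2; apply/cvgrPdist_le => e e0.
have e2 : 0 < e / 2 by rewrite divr_gt0.
have e4 : 0 < e / 2 * (e / 2) by rewrite mulr_gt0.
have l1 n : (fun w => `|U n w|) \in Lfun P 1 by apply: Lfun_norm; exact: Lfun21.
move/cvgrPdist_le : U2 => /(_ _ e4); apply: filterS => n; rewrite !sub0r !normrN.
rewrite ger0_norm; last by apply: mean_ge0 => w; exact: sqr_ge0.
rewrite [X in _ -> X <= _]ger0_norm; last by apply: mean_ge0.
move=> U2e; apply: le_trans (mean_norm_tail e2 (lU n)) _.
have : mean P (tail_sqr (e / 2) \o U n) <= mean P (fun w => U n w ^+ 2).
  apply: mean_le; [exact: Lfun1_tail_sqr|exact: Lfun2_sqr|].
  by move=> w; case/andP: (tail_sqr_itv (e / 2) (U n w)).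
move=> /le_trans/(_ U2e); rewrite -ler_pdivrMr//; lra.
Qed.

Lemma lipschitz_mean_cvg (h : R -> R) (L M : R) (U V : nat -> T -> R) :
  lipschitz_fun L h -> (forall x, `|h x| <= M) ->
  (forall n, U n \in Lfun P 2%:E) -> (forall n, V n \in Lfun P 2%:E) ->
  mean P (fun w => (U n w - V n w) ^+ 2) @[n --> \oo] --> (0 : R) ->
  mean P (h \o U n) - mean P (h \o V n) @[n --> \oo] --> (0 : R).
Proof.
move=> hL hM lU lV UV2.
have l21 : (1 <= 2%:E :> \bar R)%E by rewrite lee_fin ler1n.
have lUV n : (fun w => U n w - V n w) \in Lfun P 2%:E by exact: LfunB.
have mh := lipschitz_measurable hL.
have lh (Z : T -> R) : Z \in Lfun P 2%:E -> (h \o Z) \in Lfun P 1.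
  move=> lZ; apply: (@Lfun1_bounded _ _ _ _ _ M); last by move=> w; exact: hM.
  by apply: (measurableT_comp mh); exact: Lfun_measurable lZ.
have l1 n : (fun w => `|U n w - V n w|) \in Lfun P 1.
  by apply: Lfun_norm; exact: Lfun21.
have Lm : L * mean P (fun w => `|U n w - V n w|) @[n --> \oo] --> L * 0.
  by apply: cvgMr; exact: (mean_norm_cvg0 lUV).
rewrite mulr0 in Lm; apply/norm_cvg0P; apply: squeeze_cvgr (cvg_cst 0) Lm.
apply: nearW => n; rewrite normr_ge0/= -meanZ//.
apply: mean_normB_le; [exact: lh|exact: lh|exact: LfunZ|].
by move=> w; exact: hL.
Qed.

End mean_square.

Section partial_sums.
Context d (T : measurableType d) (R : realType) (P : probability T R).
Variable X : nat -> {RV P >-> R}.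

Let psum_seq p q : psum X p q = fun w =>
  \sum_(h <- index_iota p.+1 q.+1 | h \in index_iota p.+1 q.+1) X h w.
Proof. by apply/funext => w; rewrite /psum big_seq. Qed.

Lemma psum_cat p q r w : (p <= q <= r)%N ->
  psum X p q w + psum X q r w = psum X p r w.
Proof. by move=> /andP[pq qr]; rewrite /psum -big_cat_nat. Qed.

Lemma dominated_psum n p q : (q <= n)%N -> dominated X n (psum X p q) (psum X p q).
Proof.
move=> qn; rewrite psum_seq.
apply: dominated_sum => h; rewrite mem_index_iota => /andP[h1 h2].
by apply: dominated_X; rewrite (leq_trans _ h1)//= (leq_trans _ qn).
Qed.

Lemma dominatedZ n k (U F : T -> R) : 0 <= k -> dominated X n U F ->
  dominated X n (fun w => k * U w) (fun w => k * F w).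
Proof.
move=> k0; apply: dominated_lipschitz => x y.
by rewrite -mulrBr normrM (ger0_norm k0).
Qed.

Hypothesis X_sqint : forall j : nat, (1 <= j)%N -> (X j : T -> R) \in Lfun P 2%:E.
Hypothesis X_centered : forall j : nat, (1 <= j)%N -> ('E_P[X j] = 0)%E.

Lemma Lfun2_psum p q : psum X p q \in Lfun P 2%:E.
Proof.
rewrite psum_seq.
apply: Lfun_sum => [|h]; first by rewrite lee_fin ler1n.
by rewrite mem_index_iota => /andP[h1 _]; apply: X_sqint; apply: leq_trans h1.
Qed.

Lemma mean_psum p q : mean P (psum X p q) = 0.
Proof.
rewrite psum_seq.
have lX h : (1 <= h)%N -> (X h : T -> R) \in Lfun P 1.
  by move=> /X_sqint; exact: Lfun21.
rewrite mean_sum.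
  rewrite big1// => h; rewrite mem_index_iota => /andP[h1 _].
  have h0 : (1 <= h)%N by apply: leq_trans h1.
  by apply: EFin_inj; rewrite -expectation_mean ?X_centered// lX.
by move=> h; rewrite mem_index_iota => /andP[h1 _]; apply: lX; apply: leq_trans h1.
Qed.

Lemma ipart_le n (s t : R) : s <= t -> (ipart n s <= ipart n t)%N.
Proof. by move=> st; rewrite /ipart; apply: le_truncn; rewrite ler_wpM2l. Qed.

Lemma scaled_var k (U : T -> R) : U \in Lfun P 2%:E ->
  cov P (fun w => k * U w) (fun w => k * U w) = k ^+ 2 * var P U.
Proof.
move=> lU; rewrite var_cov// covZl ?covZr ?mulrA//.
by apply: LfunZ => //; rewrite lee_fin ler1n.
Qed.

(** Links the integral in the moving Lindeberg condition to [tail_sqr]. *)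
Lemma set_integral_tail_sqr a (D : T -> R) :
  \int[P]_(w in [set w | a <= `|D w|]) (`|D w| ^+ 2) = mean P (tail_sqr a \o D).
Proof.
rewrite Rintegral_mkcond /mean; congr (Rintegral _ _ _); apply/funext => w.
rewrite /patch /tail_sqr /=.
have -> : (w \in [set w | a <= `|D w|]) = (a <= `|D w|) by apply/idP/idP; rewrite inE.
by case: ifP => // _; rewrite real_normK ?num_real.
Qed.

(** Changes the normalization and the threshold in Lindeberg's condition at the same
    time. *)
Lemma tail_sqr_scale (c e a x : R) : 0 <= c -> (e <= c * `|x| -> a <= `|x|) ->
  tail_sqr e (c * x) <= c ^+ 2 * tail_sqr a x.
Proof.
move=> c0 ea; rewrite /tail_sqr normrM (ger0_norm c0).
case: ifPn => [/ea -> |_]; first by rewrite exprMn.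
by case: ifPn; rewrite ?mulr0// -exprMn sqr_ge0.
Qed.

Section window.
Hypothesis X_assoc : associated X.
Hypothesis s_pos : \forall n \near \oo, 0 < stdev_S X n.
Variables (s t sigma : R) (l m r : nat -> nat).
Hypotheses (st : s < t) (sigma0 : 0 < sigma).
Hypothesis blocks : block_conditions X s t l m r.
Hypothesis window_cvg :
  var P (psum X (ipart n s) (ipart n t)) / stdev_S X n ^+ 2 @[n --> \oo] --> sigma ^+ 2.

Let c n := (stdev_S X n)^-1.
Let delta n w := c n * psum X (ipart n s) (ipart n t) w.
Let xi n (j : 'I_(m n)) w := c n * block_sum X s l j.+1 n w.
Arguments xi : clear implicits.
Let rho n w := c n * block_tail X s t l m n w.
Let bsum n w := \sum_j xi n j w.

Let l21 : (1 <= 2%:E :> \bar R)%E. Proof. by rewrite lee_fin ler1n. Qed.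

Let c0 n : 0 <= c n. Proof. by rewrite invr_ge0 sqrtr_ge0. Qed.

Let windowE n : (window_start s n + window_size s t n = ipart n t)%N.
Proof. by rewrite subnKC// ipart_le// ltW. Qed.

Let mlN n : (m n * l n <= window_size s t n)%N.
Proof. by rewrite (blocks_div blocks) leq_addr. Qed.

Let sum_blocks n k w :
  \sum_(j < k) block_sum X s l j.+1 n w =
  psum X (window_start s n) (window_start s n + k * l n) w.
Proof.
elim: k => [|k IH]; first by rewrite big_ord0 mul0n addn0 /psum big_geq.
rewrite big_ord_recr/= IH /block_sum/= psum_cat// leq_addr/= leq_add2l.
by rewrite leq_mul2r leqnSn orbT.
Qed.

Let deltaE n w : delta n w = bsum n w + rho n w.
Proof.
rewrite /bsum /xi -mulr_sumr sum_blocks -mulrDr /block_tail psum_cat ?windowE//.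
by rewrite leq_addr -windowE leq_add2l mlN.
Qed.

Let lxi n j : xi n j \in Lfun P 2%:E.
Proof. by apply: LfunZ => //; exact: Lfun2_psum. Qed.

Let lrho n : rho n \in Lfun P 2%:E.
Proof. by apply: LfunZ => //; exact: Lfun2_psum. Qed.

Let lS n : bsum n \in Lfun P 2%:E.
Proof. by apply: Lfun_sum. Qed.

Let ldelta n : delta n \in Lfun P 2%:E.
Proof. by apply: LfunZ => //; exact: Lfun2_psum. Qed.

Let dxi n j : dominated X (ipart n t) (xi n j) (xi n j).
Proof.
apply: dominatedZ => //; apply: dominated_psum => /=.
rewrite -windowE leq_add2l (leq_trans _ (mlN n))// leq_mul2r.
by rewrite (ltn_ord j) orbT.
Qed.

Let drho n : dominated X (ipart n t) (rho n) (rho n).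
Proof. by apply: dominatedZ => //; apply: dominated_psum; rewrite windowE. Qed.

Let xi0 n j : mean P (xi n j) = 0.
Proof.
by rewrite meanZ ?mean_psum ?mulr0//; apply: Lfun21; exact: Lfun2_psum.
Qed.

Let window_varE n : window_var X s t n = var P (psum X (ipart n s) (ipart n t)).
Proof. by rewrite /window_var windowE. Qed.

(** The block conditions are normalized by the variance of the window itself; this
    moves them to the common normalization by [stdev_S], the ratio of the two
    tending to [sigma ^+ 2]. *)
Let cvg_ratio (u : nat -> R) (a : R) : u n / window_var X s t n @[n --> \oo] --> a ->
  c n ^+ 2 * u n @[n --> \oo] --> sigma ^+ 2 * a.
Proof.
move=> ua; apply: (cvg_near_eq _ (cvgM window_cvg ua)).
have wp := blocks_var_pos blocks; near=> n.
have w0 : window_var X s t n != 0 by rewrite gt_eqF//; near: n.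
rewrite /= -window_varE /c exprVn mulrACA.
by rewrite [X in X = _]mulrC; field; apply/andP; split => //; rewrite gt_eqF//; near: n.
Unshelve. all: by end_near. Qed.

Let V_cvg : \sum_j cov P (xi n j) (xi n j) @[n --> \oo] --> sigma ^+ 2.
Proof.
have := cvg_ratio (blocks_Ha blocks); rewrite mulr1; apply: cvg_near_eq; apply: nearW => n /=.
rewrite /block_var big_add1/= big_mkord mulr_sumr; apply: eq_bigr => j _.
by rewrite -scaled_var//; exact: Lfun2_psum.
Qed.

Let rho_cvg : mean P (fun w => rho n w ^+ 2) @[n --> \oo] --> (0 : R).
Proof.
have := cvg_ratio (blocks_Hab blocks); rewrite mulr0; apply: cvg_near_eq; apply: nearW => n /=.
rewrite -scaled_var; last exact: Lfun2_psum.
rewrite cov_centered; last by rewrite meanZ ?mean_psum ?mulr0//; apply: Lfun21; exact: Lfun2_psum.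
by congr mean; apply/funext => w; rewrite expr2.
Qed.

(** Nonnegative covariances squeeze the variance of the sum of the blocks between
    the sum of their variances and the variance of the whole window. *)
Let S_cvg : cov P (bsum n) (bsum n) @[n --> \oo] --> sigma ^+ 2.
Proof.
have cov0 n U V : dominated X (ipart n t) U U -> dominated X (ipart n t) V V ->
    U \in Lfun P 2%:E -> V \in Lfun P 2%:E -> 0 <= cov P U V.
  by move=> dU dV lU lV; apply: le_trans (dominated_cov X_assoc lU lU lV lV dU dV).
have dS n : dominated X (ipart n t) (bsum n) (bsum n) by exact: dominated_sum.
have delta_cvg : cov P (delta n) (delta n) @[n --> \oo] --> sigma ^+ 2.
  move: window_cvg; apply: cvg_near_eq; apply: nearW => n /=.
  by rewrite scaled_var ?Lfun2_psum// /c exprVn mulrC.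
apply: (@squeeze_cvgr _ _ _ _ (fun n => \sum_j cov P (xi n j) (xi n j))
  (fun n => cov P (delta n) (delta n))); [|exact: V_cvg|exact: delta_cvg].
apply: nearW => n; apply/andP; split.
  have -> : cov P (bsum n) (bsum n) = \sum_j cov P (bsum n) (xi n j) by exact: cov_sumr.
  apply: ler_sum => j _; rewrite covC.
  have -> : cov P (xi n j) (bsum n) = \sum_k cov P (xi n j) (xi n k) by exact: cov_sumr.
  rewrite (bigD1 j)//= lerDl; apply: sumr_ge0 => k _; exact: (cov0 n).
have -> : delta n = (fun w => bsum n w + rho n w) by apply/funext => w; exact: deltaE.
have lSr : (fun w => bsum n w + rho n w) \in Lfun P 2%:E by exact: LfunD.
rewrite covDl// !covDr// -addrA lerDl.
have h1 := cov0 n _ _ (dS n) (drho n) (lS n) (lrho n).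
have h2 := cov0 n _ _ (drho n) (dS n) (lrho n) (lS n).
have h3 := cov0 n _ _ (drho n) (drho n) (lrho n) (lrho n).
by rewrite addr_ge0// addr_ge0.
Qed.

(** For large n one has tau' <= 2 sigma s_n, so the threshold eps tau' of
    Lindeberg's condition at eps = e / (2 sigma) is at most e s_n. *)
Let La_cvg e : 0 < e ->
  \sum_j mean P (tail_sqr e \o xi n j) @[n --> \oo] --> (0 : R).
Proof.
move=> e0; pose eps := e / (2 * sigma).
have eps0 : 0 < eps by rewrite divr_gt0// mulr_gt0.
pose tau n := Num.sqrt (block_var X s l m n).
have tau_le : \forall n \near \oo, c n * tau n <= 2 * sigma.
  have := cvg_ratio (blocks_Ha blocks); rewrite mulr1 => bv.
  have : sigma ^+ 2 < (2 * sigma) ^+ 2 by have := exprn_gt0 2 sigma0; nra.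
  move=> /(cvgr_le _ bv); apply: filterS => n.
  have bv0 : 0 <= block_var X s l m n by apply: sumr_ge0 => j _; rewrite fine_ge0// variance_ge0.
  rewrite -(sqr_sqrtr bv0) -exprMn => h.
  by rewrite -ler_sqr// nnegrE mulr_ge0 ?sqrtr_ge0// ltW.
have := blocks_lindeberg blocks eps0.
pose Lb n := \sum_(j < m n) mean P (tail_sqr (eps * tau n) \o block_sum X s l j.+1 n).
have wc : c n ^+ 2 * window_var X s t n @[n --> \oo] --> sigma ^+ 2.
  move: window_cvg; apply: cvg_near_eq; apply: nearW => n /=.
  by rewrite window_varE /c exprVn mulrC.
move=> /(cvgM wc); rewrite mulr0 => Lc.
apply: squeeze_cvgr (cvg_cst 0) Lc.
have wp := blocks_var_pos blocks; near=> n.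
have w0 : window_var X s t n != 0 by rewrite gt_eqF//; near: n.
have cp : 0 < c n by rewrite invr_gt0; near: n.
apply/andP; split.
  by apply: sumr_ge0 => j _; apply: mean_ge0 => w; case/andP: (tail_sqr_itv e (xi n j w)).
rewrite /= -mulrA [window_var _ _ _ _ * _]mulrA divff// mul1r.
rewrite big_add1/= big_mkord mulr_sumr; apply: ler_sum => j _.
rewrite set_integral_tail_sqr.
have lD : block_sum X s l j.+1 n \in Lfun P 2%:E by exact: Lfun2_psum.
have lt := Lfun1_tail_sqr (eps * tau n) lD.
rewrite -(meanZ _ lt); apply: mean_le.
- exact: Lfun1_tail_sqr.
- exact: LfunZ.
- move=> w /=; apply: tail_sqr_scale => // ex.
  rewrite -(ler_pM2l cp); apply: le_trans ex.
  rewrite mulrCA -[leRHS](divfK (x := 2 * sigma)) -/eps; last by rewrite gt_eqF// mulr_gt0.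
  by rewrite ler_pM2l//; near: n.
Unshelve. all: by end_near. Qed.

(** The incomplete last block is negligible in mean square, and the sum of
    the full blocks satisfies Stein's identity asymptotically. *)
Lemma window_clt (h : R -> R) (L K : R) : 0 < K -> lipschitz_fun L h ->
  (forall x, K <= `|x| -> h x = 0) ->
  mean P (h \o delta n) @[n --> \oo] --> mean (normal_prob 0 sigma) h.
Proof.
move=> K0 hL hK.
have [M M0 hM] := continuous_bounded (lipschitz_continuous hL) hK.
have S2 : mean P (fun w => bsum n w ^+ 2) @[n --> \oo] --> sigma ^+ 2.
  move: S_cvg; apply: cvg_near_eq; apply: nearW => n /=.
  rewrite cov_centered; last by rewrite mean_sum ?big1// => j _; exact: Lfun21.
  by congr mean; apply/funext => w; rewrite expr2.
have hS : mean P (h \o bsum n) @[n --> \oo] --> mean (normal_prob 0 sigma) h.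
  apply: (stein_clt sigma0 lS S2 _ K0 hL hK) => f f' B f1 f2 f3 f4 f5.
  exact: (stein_limit X_assoc f1 f2 f3 f4 f5 lxi dxi xi0 V_cvg S_cvg La_cvg).
have dS : mean P (h \o delta n) - mean P (h \o bsum n) @[n --> \oo] --> (0 : R).
  apply: (lipschitz_mean_cvg hL hM ldelta lS).
  move: rho_cvg; apply: cvg_near_eq; apply: nearW => n /=.
  by congr mean; apply/funext => w; rewrite deltaE addrAC subrr add0r.
rewrite -[X in _ --> X]add0r; apply: (cvg_near_eq _ (cvgD dS hS)).
by apply: nearW => n /=; rewrite subrK.
Qed.

End window.
End partial_sums.

(** * Asymptotic independence of weakly correlated families *)
Section big_limits.
Context {R : realType}.

Lemma cvg_sumr (I : Type) (r : seq I) (A : pred I) (u : I -> nat -> R) (a : I -> R) :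
  (forall i, A i -> u i n @[n --> \oo] --> a i) ->
  \sum_(i <- r | A i) u i n @[n --> \oo] --> \sum_(i <- r | A i) a i.
Proof. by move=> ua; apply: cvg_big ua; exact: add_continuous. Qed.

Lemma cvg_prodr (I : Type) (r : seq I) (A : pred I) (u : I -> nat -> R) (a : I -> R) :
  (forall i, A i -> u i n @[n --> \oo] --> a i) ->
  \prod_(i <- r | A i) u i n @[n --> \oo] --> \prod_(i <- r | A i) a i.
Proof. by move=> ua; apply: cvg_big ua; exact: mul_continuous. Qed.

End big_limits.

Section asymptotic_independence.
Context d (T : measurableType d) (R : realType) (P : probability T R).
Variable X : nat -> {RV P >-> R}.
Hypothesis X_assoc : associated X.
Variable N : nat -> nat.

(** By induction, splitting off the first factor: its covariance with the product
    of the others is at most the sum of the pairwise covariances, weighted by the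
    Lipschitz constants. *)
Lemma asymptotic_independence q (D : 'I_q -> nat -> T -> R) (h : 'I_q -> R -> R)
    (L : 'I_q -> R) :
  (forall i n, D i n \in Lfun P 2%:E) ->
  (forall i n, dominated X (N n) (D i n) (D i n)) ->
  (forall i, lipschitz_fun (L i) (h i)) -> (forall i x, 0 <= h i x <= 1) ->
  (forall i j, i != j -> cov P (D i n) (D j n) @[n --> \oo] --> (0 : R)) ->
  mean P (fun w => \prod_i h i (D i n w)) - \prod_i mean P (h i \o D i n)
    @[n --> \oo] --> (0 : R).
Proof.
elim: q D h L => [|q IH] D h L lD dD hL h01 cov0.
  apply: cvg_near_cst; apply: nearW => n; rewrite big_ord0.
  by under [X in mean _ X]eq_fun do rewrite big_ord0; rewrite mean_cst subrr.
have l21 : (1 <= 2%:E :> \bar R)%E by rewrite lee_fin ler1n.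
have mh i : measurable_fun setT (h i) := lipschitz_measurable (hL i).
have mhD i n : measurable_fun setT (h i \o D i n).
  exact: (measurableT_comp (mh i) (Lfun_measurable (lD i n))).
pose D' i := D (lift ord0 i); pose h' i := h (lift ord0 i).
pose L' i := L (lift ord0 i).
have cov0' i j : i != j -> cov P (D' i n) (D' j n) @[n --> \oo] --> (0 : R).
  by move=> ij; apply: cov0; rewrite (inj_eq lift_inj).
have IHq := IH D' h' L' (fun i => lD _) (fun i => dD _) (fun i => hL _)
  (fun i => h01 _) cov0'.
pose U n := h ord0 \o D ord0 n.
pose V n w := \prod_i h' i (D' i n w).
have U01 n w : 0 <= U n w <= 1 by exact: h01.
have V01 n w : 0 <= V n w <= 1.
  rewrite prodr_ge0/=; last by move=> i _; case/andP: (h01 (lift ord0 i) (D' i n w)).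
  by rewrite prodr_ile1// => i _; exact: h01.
have lU n : U n \in Lfun P 2%:E.
  apply: (@Lfun2_bounded _ _ _ _ _ 1) => [|w]; first exact: mhD.
  by have /andP[a b] := U01 n w; rewrite ger0_norm.
have lV n : V n \in Lfun P 2%:E.
  apply: (@Lfun2_bounded _ _ _ _ _ 1) => [|w].
    by apply: measurable_prod => i _; exact: mhD.
  by have /andP[a b] := V01 n w; rewrite ger0_norm.
have dU n : dominated X (N n) (U n) (fun w => L ord0 * D ord0 n w).
  exact: dominated_lipschitz.
have dV n : dominated X (N n) (V n) (fun w => \sum_i L' i * D' i n w).
  apply: dominated_prod => [i w|i]; first exact: h01.
  by apply: (dominated_lipschitz (hL _)); exact: dD.
have covUV : cov P (U n) (V n) @[n --> \oo] --> (0 : R).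
  have sum0 : \sum_i L ord0 * (L' i * cov P (D ord0 n) (D' i n)) @[n --> \oo] -->
      \sum_(i < q) (0 : R).
    apply: cvg_sumr => i _; rewrite -[X in _ --> X](mulr0 (L ord0 )).
    apply: cvgMr; rewrite -[X in _ --> X](mulr0 (L' i)).
    by apply: cvgMr; apply: cov0.
  rewrite big1// in sum0.
  apply/norm_cvg0P; apply: squeeze_cvgr (cvg_cst 0) sum0.
  apply: nearW => n; rewrite normr_ge0/=.
  have lZ i : (fun w => L i * D i n w) \in Lfun P 2%:E by exact: LfunZ.
  apply: le_trans (dominated_cov X_assoc (lU n) _ (lV n) _ (dU n) (dV n)) _ => //.
    by apply: Lfun_sum => // i _; exact: lZ.
  rewrite cov_sumr//; last by move=> i _; exact: lZ.
  apply: ler_sum => i _; rewrite covZl; [|exact: lD|exact: lZ].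
  by rewrite covZr; [|exact: lD|exact: lD].
have UVb : mean P (U n) * (mean P (V n) - \prod_i mean P (h' i \o D' i n))
    @[n --> \oo] --> (0 : R).
  apply/norm_cvg0P; apply: squeeze_cvgr (cvg_cst 0) ((norm_cvg0P _).2 IHq).
  apply: nearW => n; rewrite normr_ge0/= normrM ler_piMl//.
  apply: (@le_trans _ _ (mean P (fun=> 1))); last by rewrite mean_cst.
  apply: mean_norm_le; [exact: Lfun21|exact: (Lfun_cst P 1 1)|].
  by move=> w; have /andP[a b] := U01 n w; rewrite ger0_norm.
rewrite -[X in _ --> X](addr0 0).
apply: (cvg_near_eq _ (cvgD covUV UVb)); apply: nearW => n /=.
rewrite big_ord_recl /cov.
under [X in mean P X - _ = _]eq_fun do rewrite big_ord_recl.
by rewrite /U /V /h' /D' /=; ring.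
Qed.

End asymptotic_independence.

(** * Increments of the Wiener process *)
Lemma eq_inv_close (R : realType) (x y : R) :
  (forall N, `|x - y| <= 2 * N.+1%:R^-1) -> x = y.
Proof.
move=> xy; apply/eqP; rewrite -subr_eq0 -normr_le0.
apply/ler_addgt0Pr => e e0; rewrite add0r.
apply: le_trans (xy (Num.truncn (2 / e))) _.
by rewrite ler_pdivrMr// mulrC -ler_pdivrMr// ltW// truncnS_gt.
Qed.

Section independence.
Context d (T : measurableType d) (R : realType) (Q : probability T R).
Implicit Types (h : R -> R).

Definition unit_measurable h := measurable_fun setT h /\ (forall x, 0 <= h x <= 1).

(** The lower approximation of [h] by multiples of 1 / N.+1, written as a sum of
    indicators of level sets. *)
Definition staircase (N : nat) h (x : R) : R :=
  N.+1%:R^-1 * \sum_(k < N.+1) \1_[set y | k.+1%:R / N.+1%:R <= h y] x.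

Lemma staircase_close N h x : 0 <= h x <= 1 -> `|h x - staircase N h x| <= N.+1%:R^-1.
Proof.
move=> /andP[h0 h1]; rewrite /staircase.
have N0 : 0 < N.+1%:R :> R by [].
pose f := Num.truncn (N.+1%:R * h x).
have Nh0 : 0 <= N.+1%:R * h x by rewrite mulr_ge0.
have /andP[f1 f2] := truncn_itv Nh0.
have fN : (f <= N.+1)%N by rewrite -(ler_nat R) (le_trans f1)// ler_piMr.
have -> : \sum_(k < N.+1) \1_[set y | k.+1%:R / N.+1%:R <= h y] x = f%:R :> R.
  transitivity (\sum_(k < N.+1 | (k < f)%N) (1 : R)).
    rewrite [RHS]big_mkcond/=; apply: eq_bigr => k _; rewrite indicE.
    have -> : (x \in [set y | k.+1%:R / N.+1%:R <= h y]) = (k < f)%N.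
      apply/idP/idP; rewrite inE/= ler_pdivrMr// mulrC.
        by move=> kh; rewrite /f truncn_ge_nat.
      by rewrite /f truncn_ge_nat.
    by case: ifP.
  by rewrite -(big_ord_widen _ (fun=> 1 : R) fN) sumr_const card_ord.
have -> : h x - N.+1%:R^-1 * f%:R = N.+1%:R^-1 * (N.+1%:R * h x - f%:R).
  by rewrite mulrBr mulKf// gt_eqF.
rewrite normrM ger0_norm ?invr_ge0// ler_piMr ?invr_ge0// ger0_norm ?subr_ge0//.
by move: f2; rewrite -/f -[in X in _ < X]natr1; lra.
Qed.

Lemma indic_comp (B : set R) (Z : T -> R) : \1_B \o Z = \1_(Z @^-1` B) :> (T -> R).
Proof.
by apply/funext => w; rewrite /= !indicE; congr (nat_of_bool _)%:R.
Qed.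

Lemma unit_indic (B : set R) : measurable B -> unit_measurable (\1_B).
Proof.
move=> mB; split; first exact: measurable_indic.
by move=> x; rewrite indicE; case: (_ \in _); rewrite ?lexx ?ler01.
Qed.

(** Reduces identities between means of functions with values in [0, 1] to the case
    of indicators, here the indicators of the level sets of [h]; the weight [G] is
    for factorization, and [G = 1] for equality of laws. *)
Lemma mean_staircase N h (G Z : T -> R) : measurable_fun setT G ->
  (forall w, 0 <= G w <= 1) -> measurable_fun setT Z -> unit_measurable h ->
  `|mean Q (fun w => G w * h (Z w)) - N.+1%:R^-1 * \sum_(k < N.+1)
      mean Q (fun w => G w * \1_[set y | k.+1%:R / N.+1%:R <= h y] (Z w))|
    <= N.+1%:R^-1.
Proof.
move=> mG G01 mZ hu; have [mh h01] := hu.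
have GN w : `|G w| <= 1 by have /andP[? ?] := G01 w; rewrite ger0_norm.
have lGh h' : unit_measurable h' -> (fun w => G w * h' (Z w)) \in Lfun Q 1.
  move=> [mh' h01']; apply: (@Lfun1_bounded _ _ _ _ _ 1).
    by apply: measurable_funM => //; exact: (measurableT_comp mh' mZ).
  move=> w; rewrite normrM; have /andP[? ?] := h01' (Z w).
  by rewrite mulr_ile1// ger0_norm.
pose level (k : nat) := [set y | k.+1%:R / N.+1%:R <= h y].
have mlevel k : measurable (level k).
  rewrite -[X in measurable X]setTI; exact: measurable_fun_le.
have ll (k : 'I_N.+1) : (fun w => G w * \1_(level k) (Z w)) \in Lfun Q 1.
  exact: lGh (unit_indic (mlevel k)).
have lsum : (fun w => \sum_(k < N.+1) (G w * \1_(level k) (Z w))) \in Lfun Q 1.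
  exact: Lfun_sum.
have -> : N.+1%:R^-1 * \sum_(k < N.+1) mean Q (fun w => G w * \1_(level k) (Z w)) =
    mean Q (fun w => N.+1%:R^-1 * \sum_(k < N.+1) (G w * \1_(level k) (Z w))).
  by rewrite (meanZ _ lsum) mean_sum.
rewrite -[leRHS](mean_cst Q); apply: mean_normB_le.
- exact: lGh.
- exact: LfunZ.
- exact: (Lfun_cst Q _ 1).
move=> w; rewrite -mulr_sumr mulrCA -mulrBr normrM.
by apply: le_trans (staircase_close N (h01 (Z w))); rewrite ler_piMl.
Qed.

Lemma factor_indic_ext (G Z : T -> R) h : measurable_fun setT G ->
  (forall w, 0 <= G w <= 1) -> measurable_fun setT Z ->
  (forall B : set R, measurable B ->
     mean Q (fun w => G w * \1_B (Z w)) = mean Q G * mean Q (\1_B \o Z)) ->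
  unit_measurable h ->
  mean Q (fun w => G w * h (Z w)) = mean Q G * mean Q (h \o Z).
Proof.
move=> mG G01 mZ GB hu; apply: eq_inv_close => N.
have mlevel (k : nat) : measurable [set y | k.+1%:R / N.+1%:R <= h y].
  by rewrite -[X in measurable X]setTI; apply: measurable_fun_le => //; exact: hu.1.
have one01 (w : T) : 0 <= (1 : R) <= 1 by rewrite ler01 lexx.
have := mean_staircase N mG G01 mZ hu.
have := mean_staircase N (measurable_cst (1 : R)) one01 mZ hu.
have one_mul (u : T -> R) : (fun w => 1 * u w) = u by apply/funext => w; rewrite mul1r.
rewrite one_mul.
have -> : N.+1%:R^-1 * \sum_(k < N.+1)
      mean Q (fun w => G w * \1_[set y | k.+1%:R / N.+1%:R <= h y] (Z w)) =
    mean Q G * (N.+1%:R^-1 * \sum_(k < N.+1)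
      mean Q (fun w => 1 * \1_[set y | k.+1%:R / N.+1%:R <= h y] (Z w))).
  rewrite mulrCA [mean Q G * _]mulr_sumr; congr (_ * _); apply: eq_bigr => k _.
  by rewrite GB// one_mul.
set c := N.+1%:R^-1 * _ => h1 h2.
have h3 : `|mean Q G| <= 1.
  rewrite -[leRHS](mean_cst Q); apply: mean_norm_le => [||w].
  - by apply: (@Lfun1_bounded _ _ _ _ _ 1) => // w; have /andP[? ?] := G01 w; rewrite ger0_norm.
  - exact: (Lfun_cst Q _ 1).
  - by have /andP[? ?] := G01 w; rewrite ger0_norm.
have -> : mean Q (fun w => G w * h (Z w)) - mean Q G * mean Q (h \o Z) =
  (mean Q (fun w => G w * h (Z w)) - mean Q G * c) - mean Q G * (mean Q (h \o Z) - c).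
  by ring.
rewrite (le_trans (ler_normB _ _))// mulr2n mulrDl mul1r lerD// normrM.
by rewrite -[leRHS]mul1r ler_pM.
Qed.

(** Independence is given for events. The indicators are replaced by general
    functions one index at a time, [j] being the number of indices already
    treated; each replacement is [factor_indic_ext] with the remaining product as
    [G]. *)
Lemma independent_mean k (Z : 'I_k -> T -> R) (h : 'I_k -> R -> R) :
  (forall i, measurable_fun setT (Z i)) -> independent_RVs Q Z ->
  (forall i, unit_measurable (h i)) ->
  mean Q (fun w => \prod_i h i (Z i w)) = \prod_i mean Q (h i \o Z i).
Proof.
move=> mZ indZ hu.
suff H (j : nat) : forall h : 'I_k -> R -> R, (forall i, unit_measurable (h i)) ->
    (forall i : 'I_k, (j <= i)%N -> exists2 B : set R, measurable B & h i = \1_B) ->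
    mean Q (fun w => \prod_i h i (Z i w)) = \prod_i mean Q (h i \o Z i).
  by apply: (H k) => // i; rewrite leqNgt ltn_ord.
elim: j {h hu} => [|j IH] h hu hB.
  have {}hB i : {B : set R | measurable B /\ h i = \1_B}.
    by apply: cid; have [B ? ?] := hB i (leq0n _); exists B.
  pose B i := sval (hB i).
  have mB i : measurable (B i) by case: (svalP (hB i)).
  have hE i : h i = \1_(B i) by case: (svalP (hB i)).
  have mZB i : measurable (Z i @^-1` B i).
    by rewrite -[X in measurable X]setTI; apply: mZ.
  have mI : measurable (\bigcap_(i in [set: 'I_k]) (Z i @^-1` B i)).
    by apply: fin_bigcap_measurable => // i _; exact: mZB.
  have E1 : (fun w => \prod_i h i (Z i w)) =
      \1_(\bigcap_(i in [set: 'I_k]) (Z i @^-1` B i)).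
    apply/funext => w; rewrite indicE.
    have [wI|wI] := boolP (w \in _).
      rewrite big1// => i _; rewrite hE indicE mem_set//.
      by move: wI; rewrite inE => /(_ i I).
    have [i wi] : exists i, ~ (Z i @^-1` B i) w.
      apply/existsNP => wB; move/negP : wI; apply; rewrite inE => i _; exact: wB.
    by rewrite (bigD1 i)//= hE indicE memNset// mul0r.
  rewrite E1 mean_indic// indZ//.
  have E2 i : Q (Z i @^-1` B i) = (mean Q (h i \o Z i))%:E.
    by rewrite hE indic_comp mean_indic// fineK// fin_num_measure.
  by rewrite (eq_bigr _ (fun i _ => E2 i)) prodEFin.
have [jk|kj] := ltnP j k; last first.
  by apply: IH => // i ji; move: (leq_trans kj ji); rewrite leqNgt ltn_ord.
pose jo := Ordinal jk.
pose G w := \prod_(i | i != jo) h i (Z i w).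
have mhZ i : measurable_fun setT (h i \o Z i).
  exact: (measurableT_comp (hu i).1 (mZ i)).
(* the claim for [j], used with the function at index [j] replaced by an indicator *)
pose rep g i := if i == jo then g else h i : R -> R.
have IHg (g : R -> R) : (exists2 B : set R, measurable B & g = \1_B) ->
    mean Q (fun w => G w * g (Z jo w)) =
    (\prod_(i | i != jo) mean Q (h i \o Z i)) * mean Q (g \o Z jo).
  move=> [B mB gB].
  have := IH (rep g).
  have -> : (fun w => \prod_i rep g i (Z i w)) = (fun w => G w * g (Z jo w)).
    apply/funext => w; rewrite (bigD1 jo)//= /rep eqxx mulrC; congr (_ * _).
    by apply: eq_bigr => i /negbTE ->.
  have -> : \prod_i mean Q (rep g i \o Z i) =
      (\prod_(i | i != jo) mean Q (h i \o Z i)) * mean Q (g \o Z jo).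
    rewrite (bigD1 jo)//= /rep eqxx mulrC; congr (_ * _).
    by apply: eq_bigr => i /negbTE ->.
  apply.
    by move=> i; rewrite /rep; case: eqP => // _; rewrite gB; exact: unit_indic.
  move=> i ji; rewrite /rep; case: eqP => [_|/eqP ijo]; first by exists B.
  apply: hB; rewrite ltn_neqAle ji andbT eq_sym; apply: contra ijo => /eqP ij.
  by apply/eqP/val_inj.
have GE : mean Q G = \prod_(i | i != jo) mean Q (h i \o Z i).
  have := IHg (fun=> 1); have -> : (fun w => G w * 1) = G by apply/funext => w; rewrite mulr1.
  have -> : ((fun=> 1) \o Z jo) = (fun=> 1 : R) by [].
  rewrite mean_cst mulr1; apply; exists setT => //.
  by apply/funext => x; rewrite indicE in_setT.
transitivity (mean Q (fun w => G w * h jo (Z jo w))).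
  by congr mean; apply/funext => w; rewrite (bigD1 jo)//= mulrC.
rewrite [RHS](bigD1 jo)//= mulrC -GE; apply: factor_indic_ext => //.
- have -> : G = (fun w => \prod_i (if i != jo then h i (Z i w) else 1)).
    by apply/funext => w; rewrite /G big_mkcond.
  by apply: measurable_prod => i _; case: (i != jo) => //; exact: mhZ.
- move=> w; rewrite prodr_ge0/=; last by move=> i _; case/andP: ((hu i).2 (Z i w)).
  by rewrite prodr_ile1// => i _; exact: (hu i).2.
- by move=> B mB; rewrite GE; apply: IHg; exists B.
Qed.

End independence.

Lemma same_law_mean d (T : measurableType d) d' (T' : measurableType d') (R : realType)
    (Q : probability T R) (Q' : probability T' R) (Z : T -> R) (Z' : T' -> R)
    (h : R -> R) : measurable_fun setT Z -> measurable_fun setT Z' ->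
  (forall B : set R, measurable B -> Q (Z @^-1` B) = Q' (Z' @^-1` B)) ->
  unit_measurable h -> mean Q (h \o Z) = mean Q' (h \o Z').
Proof.
move=> mZ mZ' law hu; apply: eq_inv_close => N.
have one01 U (w : U) : 0 <= (1 : R) <= 1 by rewrite ler01 lexx.
have one_mul U (u : U -> R) : (fun w => 1 * u w) = u by apply/funext => w; rewrite mul1r.
have := mean_staircase Q N (measurable_cst (1 : R)) (one01 T) mZ hu.
have := mean_staircase Q' N (measurable_cst (1 : R)) (one01 T') mZ' hu.
rewrite !one_mul.
have -> : \sum_(k < N.+1)
      mean Q (fun w => 1 * \1_[set y | k.+1%:R / N.+1%:R <= h y] (Z w)) =
    \sum_(k < N.+1)
      mean Q' (fun w => 1 * \1_[set y | k.+1%:R / N.+1%:R <= h y] (Z' w)).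
  apply: eq_bigr => k _; rewrite !one_mul.
  have mB : measurable [set y | k.+1%:R / N.+1%:R <= h y].
    by rewrite -[X in measurable X]setTI; apply: measurable_fun_le => //; exact: hu.1.
  rewrite -[X in mean Q X]/(\1_[set y | k.+1%:R / N.+1%:R <= h y] \o Z).
  rewrite -[X in mean Q' X]/(\1_[set y | k.+1%:R / N.+1%:R <= h y] \o Z').
  rewrite !indic_comp !mean_indic ?law//.
  - by rewrite -[X in measurable X]setTI; exact: mZ'.
  - by rewrite -[X in measurable X]setTI; exact: mZ.
move: (N.+1%:R^-1 * _) => c h1 h2; rewrite -(subrKA c).
by rewrite (le_trans (ler_normD _ _))// mulr2n mulrDl mul1r lerD// distrC.
Qed.

Section wiener_increments.
Context d (T : measurableType d) (R : realType) (Q : probability T R).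
Variable W : R -> {RV Q >-> R}.
Hypothesis W_wiener : standard_wiener W.

Let incr (v : nat -> R) (i : nat) : T -> R := W (v i.+1) \- W (v i).

Let measurable_incr v i : measurable_fun setT (incr v i).
Proof. by apply: measurable_funB; exact: measurable_funP. Qed.

Let strict_increments k (v : nat -> R) (h : nat -> R -> R) :
  0 <= v 0%N -> (forall i, (i < k)%N -> v i < v i.+1) -> v k <= 1 ->
  (forall i, unit_measurable (h i)) ->
  mean Q (fun w => \prod_(i < k) h i (incr v i w)) =
  \prod_(i < k) mean Q (h i \o incr v i).
Proof.
move=> v0 vS vk hu.
apply: (independent_mean (Z := fun i : 'I_k => incr v i) (h := fun i : 'I_k => h i)) => //.
exact: (wiener_independent W_wiener).
Qed.

(** The time change may be constant on some intervals, whereas increments of [W] are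
    known to be independent along strictly increasing times. Where two times
    coincide the increment is 0 and its factor is a constant, collected in
    [c]. *)
Let merge k (v : nat -> R) (h : nat -> R -> R) :
  (forall i, (i < k)%N -> v i <= v i.+1) -> (forall i, unit_measurable (h i)) ->
  exists (k' : nat) (v' : nat -> R) (h' : nat -> R -> R) (c : R), [/\ v' 0%N = v 0%N /\ v' k' = v k,
    (forall i, (i < k')%N -> v' i < v' i.+1), (forall i, unit_measurable (h' i)),
    (forall w, \prod_(i < k) h i (incr v i w) = c * \prod_(i < k') h' i (incr v' i w)) &
    \prod_(i < k) mean Q (h i \o incr v i) =
      c * \prod_(i < k') mean Q (h' i \o incr v' i) :> R].
Proof.
elim: k => [|k IH] vS hu.
  by exists 0%N, v, h, 1; split => // [w|]; rewrite !big_ord0 mulr1.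
have [k' [v' [h' [c [[v0 vk] v'S h'u E1 E2]]]]] := IH (fun i ik => vS i (ltnW ik)) hu.
have [vkk|vkk] := eqVneq (v k) (v k.+1).
  exists k', v', h', (c * h k 0); split => //.
  - by rewrite -vkk.
  - by move=> w; rewrite big_ord_recr/= E1 /incr vkk/= subrr mulrAC.
  - rewrite big_ord_recr/= E2.
    have -> : h k \o incr v k = (fun=> h k 0).
      by apply/funext => w; rewrite /incr/= vkk subrr.
    by rewrite mean_cst mulrAC.
pose v2 i := if (i <= k')%N then v' i else v k.+1.
pose h2 i := if (i < k')%N then h' i else h k.
have i2 (i : 'I_k') : incr v2 i = incr v' i.
  by rewrite /incr /v2 (ltnW (ltn_ord i)) (ltn_ord i).
have i2k : incr v2 k' = incr v k by rewrite /incr /v2 ltnn leqnn vk.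
have h2E (i : 'I_k') : h2 i = h' i by rewrite /h2 ltn_ord.
have h2k : h2 k' = h k by rewrite /h2 ltnn.
exists k'.+1, v2, h2, c; split.
- by rewrite /v2 leq0n ltnn.
- move=> i; rewrite ltnS leq_eqVlt => /predU1P[->|ik'].
    by rewrite /v2 leqnn ltnn vk lt_neqAle vkk vS.
  by rewrite /v2 (ltnW ik') ik' v'S.
- by move=> i; rewrite /h2; case: ifP.
- move=> w; rewrite !big_ord_recr/= E1 i2k h2k mulrA; congr (_ * _ * _).
  by apply: eq_bigr => i _; rewrite i2 h2E.
- rewrite !big_ord_recr/= E2 i2k h2k mulrA; congr (_ * _ * _).
  by apply: eq_bigr => i _; rewrite i2 h2E.
Qed.

Lemma wiener_increments_mean k (v : nat -> R) (h : nat -> R -> R) :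
  0 <= v 0%N -> (forall i, (i < k)%N -> v i <= v i.+1) -> v k <= 1 ->
  (forall i, unit_measurable (h i)) ->
  mean Q (fun w => \prod_(i < k) h i (W (v i.+1) w - W (v i) w)) =
  \prod_(i < k) mean Q (fun w => h i (W (v i.+1) w - W (v i) w)).
Proof.
move=> v0 vS vk hu.
have [k' [v' [h' [c [[v0' vk'] v'S h'u E1 E2]]]]] := merge vS hu.
rewrite -[v 0%N]v0' in v0; rewrite -[v k]vk' in vk.
transitivity (\prod_(i < k) mean Q (h i \o incr v i)) => //.
rewrite E2 -strict_increments// -meanZ.
  by congr mean; apply/funext => w; exact: E1.
apply: (@Lfun1_bounded _ _ _ _ _ 1).
  apply: measurable_prod => i _; apply: (measurableT_comp (h'u i).1).
  exact: measurable_incr.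
move=> w; have p0 : 0 <= \prod_(i < k') h' i (incr v' i w).
  by apply: prodr_ge0 => i _; case/andP: ((h'u i).2 (incr v' i w)).
by rewrite ger0_norm// prodr_ile1// => i _; exact: (h'u i).2.
Qed.

(** The laws are compared through level sets because the real line underlying
    [normal_prob] carries its own measurable structure. *)
Lemma wiener_increment_law (s t : R) (h : R -> R) : 0 <= s -> s < t -> t <= 1 ->
  unit_measurable h ->
  mean Q (fun w => h (W t w - W s w)) = mean (normal_prob 0 (Num.sqrt (t - s))) h.
Proof.
move=> s0 st t1 [mh h01].
pose Z : {RV Q >-> R} := W t \- W s.
have := @same_law_mean _ _ _ _ _ Q (normal_prob 0 (Num.sqrt (t - s))) Z id h.
apply => //.
by move=> B mB; rewrite (wiener_normal W_wiener).
Qed.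

End wiener_increments.


(** * Weak convergence tested on products of bumps *)
Section bump.
Context {R : realType}.
Implicit Types (c x : R).

(** The tent of height 1 and half-width 1 centered at [c]. As a difference of two
    ramps it makes sums over consecutive integers telescope. *)
Definition bump c x : R := ramp (x - c + 1) - ramp (x - c).

Lemma bump_itv c x : 0 <= bump c x <= 1.
Proof.
have /andP[h1 h2] := ramp_itv (x - c + 1); have /andP[h3 h4] := ramp_itv (x - c).
have h : ramp (x - c) <= ramp (x - c + 1) by apply: ramp_homo; lra.
by rewrite /bump; apply/andP; split; lra.
Qed.

Lemma bump_far c x : 1 <= `|x - c| -> bump c x = 0.
Proof.
rewrite ler_normr /bump => /orP[h|h].
  by rewrite !ramp_ge1 ?subrr//; lra.
by rewrite !ramp_le0 ?subrr//; lra.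
Qed.

Lemma bump_lipschitz c (s : R) : 0 <= s -> lipschitz_fun (2 * s) (fun x => bump c (s * x)).
Proof.
move=> s0 x y; rewrite /bump.
have -> : ramp (s * x - c + 1) - ramp (s * x - c) -
   (ramp (s * y - c + 1) - ramp (s * y - c)) =
  (ramp (s * x - c + 1) - ramp (s * y - c + 1)) -
  (ramp (s * x - c) - ramp (s * y - c)) by ring.
rewrite (le_trans (ler_normB _ _))//.
have := ramp_dist (s * x - c + 1) (s * y - c + 1).
have := ramp_dist (s * x - c) (s * y - c).
have -> : s * x - c + 1 - (s * y - c + 1) = s * (x - y) by ring.
have -> : s * x - c - (s * y - c) = s * (x - y) by ring.
rewrite normrM (ger0_norm s0); lra.
Qed.

(** The sum is 1 for |x| <= M and stays in [0, 1] everywhere: a partition of unity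
    on [-M, M]. *)
Lemma sum_bump (M : nat) x :
  \sum_(k < M.*2.+1) bump (k%:R - M%:R) x = ramp (x + M%:R + 1) - ramp (x - M%:R).
Proof.
pose u k := - ramp (x - (k%:R - M%:R) + 1).
rewrite -(big_mkord xpredT (fun k => bump (k%:R - M%:R) x)).
rewrite (eq_bigr (fun k => u k.+1 - u k)) => [|k _].
  rewrite telescope_sumr// /u opprK addrC; congr (ramp _ - ramp _); first by ring.
  by rewrite -addnn -natr1 natrD; ring.
rewrite /u /bump.
have -> : x - (k.+1%:R - M%:R) + 1 = x - (k%:R - M%:R) by rewrite -natr1; ring.
by ring.
Qed.

End bump.

Section grid_approximation.
Context {R : realType} (q : nat).
Implicit Types (x y : 'rV[R]_q) (g : 'rV[R]_q -> R).

Let index (s : nat) := {ffun 'I_q -> 'I_(s * s).*2.+1}.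

(** The grid has mesh 1 / s and covers the cube [-s, s]^q, so both tend to their
    limits with a single parameter; nodes are scaled by [s] to be integers. *)
Definition node s (phi : index s) (i : 'I_q) : R := (phi i)%:R - (s * s)%:R.

Definition weight s (phi : index s) x : R := \prod_i bump (node phi i) (s%:R * x 0 i).

Definition approx s g x : R :=
  \sum_(phi : index s) g (\row_i (node phi i / s%:R)) * weight phi x.

Lemma weight_itv s (phi : index s) x : 0 <= weight phi x <= 1.
Proof.
rewrite /weight prodr_ge0/=; last by move=> i _; case/andP: (bump_itv (node phi i) (s%:R * x 0 i)).
by rewrite prodr_ile1// => i _; exact: bump_itv.
Qed.

Lemma sum_weight s x : \sum_(phi : index s) weight phi x =
  \prod_i (ramp (s%:R * x 0 i + (s * s)%:R + 1) - ramp (s%:R * x 0 i - (s * s)%:R)).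
Proof.
under [RHS]eq_bigr do rewrite -sum_bump.
by rewrite bigA_distr_bigA.
Qed.

Lemma sum_weight_le1 s x : \sum_(phi : index s) weight phi x <= 1.
Proof.
rewrite sum_weight; apply: prodr_ile1 => i _.
set a := s%:R * x 0 i; have /andP[h1 h2] := ramp_itv (a + (s * s)%:R + 1).
have /andP[h3 h4] := ramp_itv (a - (s * s)%:R).
have n0 : 0 <= (s * s)%:R :> R by [].
have h : ramp (a - (s * s)%:R) <= ramp (a + (s * s)%:R + 1) by apply: ramp_homo; lra.
by apply/andP; split; lra.
Qed.

Lemma sum_weight1 s x : (forall i, `|x 0 i| <= s%:R) ->
  \sum_(phi : index s) weight phi x = 1.
Proof.
move=> xs; rewrite sum_weight big1// => i _.
have : `|s%:R * x 0 i| <= (s * s)%:R by rewrite normrM natrM ler_pM// ger0_norm.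
rewrite ler_norml => /andP[h1 h2].
by rewrite ramp_ge1 ?ramp_le0 ?subr0//; lra.
Qed.

Lemma approx_bound s g C x : (forall y, `|g y| <= C) -> `|approx s g x| <= C.
Proof.
move=> gC; have C0 : 0 <= C by apply: le_trans (gC 0).
apply: le_trans (ler_norm_sum _ _ _) _.
apply: (@le_trans _ _ (\sum_(phi : index s) C * weight phi x)).
  apply: ler_sum => phi _; have /andP[w0 _] := weight_itv phi x.
  by rewrite normrM (ger0_norm w0) ler_wpM2r.
by rewrite -mulr_sumr ler_piMr// sum_weight_le1.
Qed.

(** Nodes at distance more than 1 / s from [x] in some coordinate have weight 0, and
    the weights add up to 1. *)
Lemma approx_close s g x e : (0 < s)%N -> (forall i, `|x 0 i| <= s%:R) ->
  (forall y, (forall i, `|x 0 i - y 0 i| <= s%:R^-1) -> `|g y - g x| <= e) ->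
  `|approx s g x - g x| <= e.
Proof.
move=> s0 xs gx; have s0' : 0 < s%:R :> R by rewrite ltr0n.
rewrite -[g x]mulr1 -(sum_weight1 xs) mulr_sumr -sumrB.
apply: le_trans (ler_norm_sum _ _ _) _.
apply: (@le_trans _ _ (\sum_(phi : index s) e * weight phi x)); last first.
  by rewrite -mulr_sumr (sum_weight1 xs) mulr1.
apply: ler_sum => phi _; have /andP[w0 _] := weight_itv phi x.
rewrite -mulrBl normrM (ger0_norm w0).
have [->|wN0] := eqVneq (weight phi x) 0; first by rewrite !mulr0.
rewrite ler_wpM2r//; apply: gx => i; rewrite mxE leNgt; apply/negP => far.
move/eqP : wN0; apply; rewrite /weight (bigD1 i)//= bump_far ?mul0r//.
have -> : s%:R * x 0 i - node phi i = s%:R * (x 0 i - node phi i / s%:R).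
  by rewrite mulrBr mulrCA divff ?mulr1 ?gt_eqF.
by rewrite normrM gtr0_norm// -ler_pdivrMl// mulr1 ltW.
Qed.

(** Joint convergence in the point and the mesh, from which both pointwise
    convergence and, by compactness, uniform convergence on cubes follow. *)
Lemma approx_near g x e : continuous g -> 0 < e ->
  \forall x' \near x & N \near \oo, `|approx N.+1 g x' - g x'| <= e.
Proof.
move=> cg e0; have e2 : 0 < e / 2 by rewrite divr_gt0.
have /cvgrPdist_le/(_ _ e2)/nbhs_ballP[de /= de0 gde] := cg x.
have de2 : 0 < de / 2 by rewrite divr_gt0.
have gx' y : (forall i, `|x 0 i - y 0 i| < de) -> `|g x - g y| <= e / 2.
  move=> xy; apply: gde; split => // i j; rewrite ord1; exact: xy.
near=> x' N => /=.
have xx' i : `|x 0 i - x' 0 i| < de / 2.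
  have : ball x (de / 2) x' by near: x'; exact: nbhsx_ballx.
  by case=> _; apply.
have Ninv : N.+1%:R^-1 < de / 2 by near: N; exact: near_infty_natSinv_lt (PosNum de2).
apply: approx_close => //.
  move=> i; apply: (@le_trans _ _ N%:R); last by rewrite ler_nat.
  apply: (@le_trans _ _ (\sum_k `|x 0 k| + de / 2)).
    have xi : `|x 0 i| <= \sum_k `|x 0 k| by rewrite (bigD1 i)//= lerDl sumr_ge0.
    have := ler_normB (x 0 i) (x 0 i - x' 0 i); rewrite subKr.
    by have := xx' i; lra.
  by near: N; exact: nbhs_infty_ger.
move=> y x'y; rewrite (splitr e).
have -> : g y - g x' = (g x - g x') - (g x - g y) by ring.
rewrite (le_trans (ler_normB _ _))// lerD//; apply: gx' => i.
  by apply: lt_trans (xx' i) _; lra.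
have -> : x 0 i - y 0 i = (x 0 i - x' 0 i) + (x' 0 i - y 0 i) by ring.
rewrite (le_lt_trans (ler_normD _ _))//.
by rewrite (splitr de) ltrD//; exact: le_lt_trans (x'y i) Ninv.
Unshelve. all: by end_near. Qed.

Lemma approx_cvg g x : continuous g -> approx N.+1 g x @[N --> \oo] --> g x.
Proof.
move=> cg; apply/cvgrPdist_le => e e0.
have [[A B] /= [xA oB] AB] := approx_near x cg e0.
apply: filterS oB => N BN; rewrite distrC; apply: (AB (x, N)).
by split => //; exact: nbhs_singleton.
Qed.

Lemma approx_unif g K e : continuous g -> 0 < e -> 0 <= K ->
  \forall N \near \oo, forall x, (forall i, `|x 0 i| <= K) -> `|approx N.+1 g x - g x| <= e.
Proof.
move=> cg e0 K0.
have cK : compact [set x : 'rV[R]_q | forall i, `[- K, K]%classic (x 0 i)].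
  by apply: (@rV_compact R q (fun=> `[- K, K]%classic)) => i; exact: segment_compact.
have FF : Filter (nbhs (\oo : set_system nat)) by exact: _.
have := (compact_near_coveringP _).1 cK nat \oo
  (fun N x => `|approx N.+1 g x - g x| <= e) FF (fun x _ => approx_near x cg e0).
apply: filterS => N H x xK; apply: H => i /=.
by rewrite in_itv/= -ler_norml.
Qed.

End grid_approximation.

Section row_measurability.
Context d (T : measurableType d) (R : realType) (q : nat).
Variable V : 'I_q -> T -> R.
Hypothesis mV : forall i, measurable_fun setT (V i).

Lemma measurable_approx s (g : 'rV[R]_q -> R) :
  measurable_fun setT (fun w => approx s g (\row_i V i w)).
Proof.
apply: measurable_sum => phi; apply: measurable_funM => //.
apply: measurable_prod => i _.
under eq_fun do rewrite mxE.
have s0 : 0 <= s%:R :> R by [].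
have mb := lipschitz_measurable (bump_lipschitz (node phi i : R) s0).
have mbV := measurableT_comp mb (mV i).
exact: mbV.
Qed.

(** A continuous function on R^q is the pointwise limit of its grid approximations,
    which are measurable functions of the coordinates. *)
Lemma measurable_continuous_row (g : 'rV[R]_q -> R) : continuous g ->
  measurable_fun setT (fun w => g (\row_i V i w)).
Proof.
move=> cg; apply: (@measurable_fun_cvg _ _ _ _ (fun N w => approx N.+1 g (\row_i V i w))).
- by move=> N; exact: measurable_approx.
- by move=> w _; exact: approx_cvg.
Qed.

End row_measurability.

Section criterion.
Context d (T : measurableType d) d' (T' : measurableType d') (R : realType).
Variables (P : probability T R) (Q : probability T' R) (q : nat).
Variables (U : nat -> 'I_q -> T -> R) (Z : 'I_q -> T' -> R) (C : R).
Hypothesis lU : forall n i, U n i \in Lfun P 2%:E.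
Hypothesis U_tight : forall i, \forall n \near \oo, mean P (fun w => U n i w ^+ 2) <= C.
Hypothesis mZ : forall i, measurable_fun setT (Z i).
Hypothesis UZ : forall (h : 'I_q -> R -> R) (L K : R), 0 < K ->
  (forall i, lipschitz_fun L (h i)) -> (forall i x, 0 <= h i x <= 1) ->
  (forall i x, K <= `|x| -> h i x = 0) ->
  mean P (fun w => \prod_i h i (U n i w)) @[n --> \oo] -->
  mean Q (fun w => \prod_i h i (Z i w)).

Let mU n i : measurable_fun setT (U n i). Proof. exact: Lfun_measurable (lU n i). Qed.

Let approx_mean_cvg s (g : 'rV[R]_q -> R) : (0 < s)%N ->
  mean P (fun w => approx s g (\row_i U n i w)) @[n --> \oo] -->
  mean Q (fun w => approx s g (\row_i Z i w)).
Proof.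
move=> s0; have s0' : 0 < s%:R :> R by rewrite ltr0n.
have lw d0 (T0 : measurableType d0) (P0 : probability T0 R) (V : 'I_q -> T0 -> R)
    (phi : {ffun 'I_q -> 'I_(s * s).*2.+1}) : (forall i, measurable_fun setT (V i)) ->
    (fun w => \prod_i bump (node phi i) (s%:R * V i w)) \in Lfun P0 1.
  move=> mV; apply: (@Lfun1_bounded _ _ _ _ _ 1).
    apply: measurable_prod => i _.
    have mb := lipschitz_measurable (bump_lipschitz (node phi i : R) (ltW s0')).
    have mbV := measurableT_comp mb (mV i).
    exact: mbV.
  move=> w; rewrite ger0_norm; last first.
    by apply: prodr_ge0 => i _; case/andP: (bump_itv (node phi i) (s%:R * V i w)).
  by apply: prodr_ile1 => i _; exact: bump_itv.
have mE d0 (T0 : measurableType d0) (P0 : probability T0 R) (V : 'I_q -> T0 -> R) :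
    (forall i, measurable_fun setT (V i)) ->
    mean P0 (fun w => approx s g (\row_i V i w)) =
    \sum_(phi : {ffun 'I_q -> 'I_(s * s).*2.+1}) g (\row_i (node phi i / s%:R)) *
      mean P0 (fun w => \prod_i bump (node phi i) (s%:R * V i w)).
  move=> mV.
  have -> : (fun w => approx s g (\row_i V i w)) = fun w =>
      \sum_(phi : {ffun 'I_q -> 'I_(s * s).*2.+1}) g (\row_i (node phi i / s%:R)) *
        \prod_i bump (node phi i) (s%:R * V i w).
    apply/funext => w; apply: eq_bigr => phi _; congr (_ * _).
    by apply: eq_bigr => i _; rewrite mxE.
  rewrite mean_sum; last by move=> phi _; apply: LfunZ => //; exact: lw.
  by apply: eq_bigr => phi _; rewrite meanZ//; exact: lw.
rewrite mE//; under eq_fun do rewrite mE//.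
apply: cvg_sumr => phi _; apply: cvgMr.
pose K : R := (s * s)%:R + 1.
have K0 : 0 < K by rewrite ltr_wpDl.
apply: (UZ (h := fun i x => bump (node phi i) (s%:R * x)) (L := 2 * s%:R) K0) => //.
- by move=> i; apply: bump_lipschitz; exact: ltW.
- by move=> i x; exact: bump_itv.
- move=> i x Kx; apply: bump_far.
  have nodeM : `|node phi i : R| <= (s * s)%:R.
    rewrite /node ler_norml; apply/andP; split; first by rewrite lerBrDl subrr.
    rewrite lerBlDr -natrD ler_nat addnn -ltnS; exact: ltn_ord.
  have sx : `|x| <= `|s%:R * x| by rewrite normrM (gtr0_norm s0') ler_peMl// ler1n.
  have := lerB_dist (s%:R * x) (node phi i); move: Kx; rewrite /K; lra.
Qed.

(** The grid approximation is a finite combination of products of bumps, to which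
    [UZ] applies. It is uniformly close to [g] on the cube [-K, K]^q, outside which
    both are bounded by [G] and 1 <= sum_i x_i^2 / K^2; hence the bound
    e / 4 + 2 G / K^2 sum_i x_i^2 on their difference. *)
Lemma weak_cvg_product_test (g : 'rV[R]_q -> R) G : continuous g -> (forall x, `|g x| <= G) ->
  mean P (fun w => g (\row_i U n i w)) @[n --> \oo] --> mean Q (fun w => g (\row_i Z i w)).
Proof.
move=> cg gG; have G0 : 0 <= G by apply: le_trans (gG 0).
have lga d0 (T0 : measurableType d0) (P0 : probability T0 R) (V : 'I_q -> T0 -> R) s :
    (forall i, measurable_fun setT (V i)) ->
    (fun w => approx s g (\row_i V i w)) \in Lfun P0 1.
  move=> mV; apply: (@Lfun1_bounded _ _ _ _ _ G); first exact: measurable_approx.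
  by move=> w; exact: approx_bound.
have lg d0 (T0 : measurableType d0) (P0 : probability T0 R) (V : 'I_q -> T0 -> R) :
    (forall i, measurable_fun setT (V i)) ->
    (fun w => g (\row_i V i w)) \in Lfun P0 1.
  by move=> mV; apply: (@Lfun1_bounded _ _ _ _ _ G); first exact: measurable_continuous_row.
have approxZ : mean Q (fun w => approx N.+1 g (\row_i Z i w)) @[N --> \oo] -->
    mean Q (fun w => g (\row_i Z i w)).
  apply: (@mean_dominated_cvg _ _ _ _ _ _ (fun=> G)).
  - by move=> N; exact: measurable_approx.
  - exact: measurable_continuous_row.
  - exact: (Lfun_cst Q G 1).
  - by move=> N w; exact: approx_bound.
  - by move=> w; exact: approx_cvg.
apply/cvgrPdist_le => e e0; have e4 : 0 < e / 4 by rewrite divr_gt0.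
(* K is so large that the mass outside the cube [-K, K]^q is negligible *)
pose K := Num.sqrt (2 * G * (q%:R * `|C|) / (e / 4)) + 1.
have K0 : 0 < K by rewrite ltr_wpDl// sqrtr_ge0.
have K2 : 2 * G * (q%:R * `|C|) / K ^+ 2 <= e / 4.
  have A0 : 0 <= 2 * G * (q%:R * `|C|) / (e / 4).
    by rewrite divr_ge0 ?(ltW e4)// !mulr_ge0.
  rewrite ler_pdivrMr ?exprn_gt0// [leRHS]mulrC -ler_pdivrMr// -[leLHS](sqr_sqrtr A0).
  by rewrite lerXn2r ?nnegrE ?sqrtr_ge0 ?(ltW K0)// /K lerDl.
have [N [NZ NU]] : exists N : nat,
    `|mean Q (fun w => g (\row_i Z i w)) - mean Q (fun w => approx N.+1 g (\row_i Z i w))|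
      <= e / 4 /\
    (forall x : 'rV[R]_q, (forall i, `|x 0 i| <= K) -> `|approx N.+1 g x - g x| <= e / 4).
  move/cvgrPdist_le : approxZ => /(_ _ e4) h1.
  have h2 := approx_unif cg e4 (ltW K0).
  by have [M _ /(_ M (leqnn M))[? ?]] := filterI h1 h2; exists M.
have tight : \forall n \near \oo, forall i, mean P (fun w => U n i w ^+ 2) <= C.
  exact: filter_forall U_tight.
have := @approx_mean_cvg N.+1 g isT => /cvgrPdist_le/(_ _ e4).
move: tight; apply: filterS2 => n Cn hn.
have lU2 i : (fun w => U n i w ^+ 2) \in Lfun P 1 by exact: Lfun2_sqr.
have lsum : (fun w => \sum_i U n i w ^+ 2) \in Lfun P 1 by apply: Lfun_sum.
have close : `|mean P (fun w => approx N.+1 g (\row_i U n i w)) -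
    mean P (fun w => g (\row_i U n i w))| <= e / 4 + e / 4.
  apply: (@le_trans _ _ (mean P (fun w => e / 4 + 2 * G / K ^+ 2 * \sum_i U n i w ^+ 2))).
    apply: mean_normB_le; [exact: lga|exact: lg| |].
      by apply: LfunD => //; [exact: (Lfun_cst P _ 1)|exact: LfunZ].
    move=> w; set x := \row_i U n i w.
    have sum0 : 0 <= \sum_i U n i w ^+ 2 by apply: sumr_ge0 => i _; exact: sqr_ge0.
    have c0 : 0 <= 2 * G / K ^+ 2 by rewrite divr_ge0 ?sqr_ge0// mulr_ge0.
    have [xK|] := pselect (forall i, `|x 0 i| <= K).
      by rewrite (le_trans (NU x xK))// lerDl mulr_ge0.
    move=> /existsNP[i /negP]; rewrite -ltNge mxE => Ki.
    apply: (@le_trans _ _ (2 * G)).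
      rewrite (le_trans (ler_normB _ _))// mulr2n mulrDl mul1r lerD//.
      exact: approx_bound.
    rewrite -[leLHS]add0r lerD ?(ltW e4)// mulrAC ler_pdivlMr ?exprn_gt0//.
    rewrite ler_wpM2l ?mulr_ge0// (bigD1 i)//= ler_wpDr//.
      by apply: sumr_ge0 => j _; exact: sqr_ge0.
    by rewrite -(real_normK (num_real (U n i w))) lerXn2r ?nnegrE// ltW.
  rewrite meanD; [|exact: (Lfun_cst P _ 1)|exact: LfunZ].
  rewrite mean_cst meanZ// mean_sum// lerD2l; apply: le_trans K2.
  have c0 : 0 <= 2 * G / K ^+ 2 by rewrite divr_ge0 ?sqr_ge0// mulr_ge0.
  rewrite [leRHS]mulrAC ler_wpM2l//.
  apply: (@le_trans _ _ (\sum_(i < q) `|C|)).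
    by apply: ler_sum => i _; apply: le_trans (Cn i) _; exact: ler_norm.
  by rewrite sumr_const card_ord mulr_natl.
have -> : mean Q (fun w => g (\row_i Z i w)) - mean P (fun w => g (\row_i U n i w)) =
  (mean Q (fun w => g (\row_i Z i w)) - mean Q (fun w => approx N.+1 g (\row_i Z i w))) +
  (mean Q (fun w => approx N.+1 g (\row_i Z i w)) -
    mean P (fun w => approx N.+1 g (\row_i U n i w))) +
  (mean P (fun w => approx N.+1 g (\row_i U n i w)) -
    mean P (fun w => g (\row_i U n i w))) by ring.
rewrite (le_trans (ler_normD _ _))// (le_trans (lerD (ler_normD _ _) (lexx _)))//.
by move: NZ hn close; lra.
Qed.

End criterion.

(** * Finite-dimensional distributions *)
Lemma continuous_row_mx (R : realType) q k (F : 'I_k -> 'rV[R]_q -> R) :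
  (forall i, continuous (F i)) -> continuous (fun x => \row_i F i x : 'rV[R]_k).
Proof.
move=> cF x B /nbhs_ballP[e /= e0 eB].
have : \forall y \near x, forall i, ball (F i x) e (F i y).
  have FF : Filter (nbhs x) by exact: nbhs_filter.
  apply: (@filter_forall _ _ _ (nbhs x) FF) => i.
  by have /cvgrPdist_lt/(_ _ e0) := cF i x.
apply: filterS => y xy; apply: eB; split => // i j; rewrite !mxE; exact: xy.
Qed.

Section increments.
Context (R : realType) d (T : measurableType d) (P : probability T R).
Variables (X : nat -> {RV P >-> R}) (a : R -> R).
Hypothesis X_assoc : associated X.
Hypothesis X_centered : forall j : nat, (1 <= j)%N -> ('E_P[X j] = 0)%E.
Hypothesis X_sqint : forall j : nat, (1 <= j)%N -> (X j : T -> R) \in Lfun P 2%:E.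
Hypothesis s_pos : \forall n \near \oo, 0 < stdev_S X n.
Hypothesis hyp_i : forall s1 s2 t1 t2 : R,
  0 <= s1 -> s1 < s2 -> s2 <= t1 -> t1 < t2 -> t2 <= 1 ->
  var P (psum X (ipart n s1) (ipart n s2) \+
         psum X (ipart n t1) (ipart n t2)) / stdev_S X n ^+ 2
    @[n --> \oo] --> (a s2 - a s1) + (a t2 - a t1).

Definition increment (s t : R) n w : R :=
  (stdev_S X n)^-1 * psum X (ipart n s) (ipart n t) w.

Let l21 : (1 <= 2%:E :> \bar R)%E. Proof. by rewrite lee_fin ler1n. Qed.

Let lpsum p q : psum X p q \in Lfun P 2%:E. Proof. exact: Lfun2_psum. Qed.

Lemma Lfun2_increment s t n : increment s t n \in Lfun P 2%:E.
Proof. exact: LfunZ. Qed.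

Lemma mean_increment s t n : mean P (increment s t n) = 0.
Proof. by rewrite meanZ ?mean_psum ?mulr0//; exact: Lfun21. Qed.

Lemma ipart0 n : ipart n (0 : R) = 0%N.
Proof. by rewrite /ipart mulr0 truncn0. Qed.

Lemma ipart1 n : ipart n (1 : R) = n.
Proof. by rewrite /ipart mulr1 natrK. Qed.

Lemma psum_split n (s c t : R) : s <= c -> c <= t ->
  psum X (ipart n s) (ipart n c) \+ psum X (ipart n c) (ipart n t) =
  psum X (ipart n s) (ipart n t).
Proof.
by move=> sc ct; apply/funext => w; rewrite /= psum_cat// !ipart_le.
Qed.

(** [hyp_i] applied to two adjacent halves of the window. *)
Lemma window_var_cvg (s t : R) : 0 <= s -> s < t -> t <= 1 ->
  var P (psum X (ipart n s) (ipart n t)) / stdev_S X n ^+ 2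
    @[n --> \oo] --> a t - a s.
Proof.
move=> s0 st t1; pose c := (s + t) / 2.
have sc : s < c by rewrite /c ltr_pdivlMr//; lra.
have ct : c < t by rewrite /c ltr_pdivrMr//; lra.
have := hyp_i s0 sc (lexx c) ct t1.
have -> : a c - a s + (a t - a c) = a t - a s by ring.
have -> : (fun n => var P (psum X (ipart n s) (ipart n c) \+
    psum X (ipart n c) (ipart n t)) / stdev_S X n ^+ 2) =
    (fun n => var P (psum X (ipart n s) (ipart n t)) / stdev_S X n ^+ 2).
  by apply/funext => n; rewrite psum_split// ltW.
exact.
Qed.

Lemma increment_var_cvg (s t : R) : 0 <= s -> s < t -> t <= 1 ->
  mean P (fun w => increment s t n w ^+ 2) @[n --> \oo] --> a t - a s.
Proof.
move=> s0 st t1; apply: (cvg_near_eq _ (window_var_cvg s0 st t1)); apply: nearW => n.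
rewrite mulrC -exprVn -scaled_var// cov_centered; last exact: mean_increment.
by congr mean; apply/funext => w; rewrite expr2.
Qed.

Lemma time_change_homo (s t : R) : 0 <= s -> s <= t -> t <= 1 -> a s <= a t.
Proof.
move=> s0; rewrite le_eqVlt => /predU1P[->//|st] t1; rewrite -subr_ge0.
apply: (cvgr_to_ge (increment_var_cvg s0 st t1)); apply: nearW => n.
by apply: mean_ge0 => w; exact: sqr_ge0.
Qed.

(** For the window [0, 1] the ratio of variances is 1 as soon as s_n > 0. *)
Lemma time_change1 : a 1 - a 0 = 1.
Proof.
have := window_var_cvg (lexx 0) ltr01 (lexx 1).
have h : var P (psum X (ipart n (0 : R)) (ipart n (1 : R))) / stdev_S X n ^+ 2
    @[n --> \oo] --> (1 : R).
  apply: cvg_near_cst; near=> n; rewrite ipart0 ipart1.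
  have sn : 0 < stdev_S X n by near: n.
  rewrite /stdev_S sqr_sqrtr; last by rewrite fine_ge0// variance_ge0.
  rewrite divff// gt_eqF//; move: sn; rewrite /stdev_S sqrtr_gt0.
  exact.
by move=> /cvg_lim h1; rewrite -[LHS]h1//; exact: cvg_lim h.
Unshelve. all: by end_near. Qed.

(** Polarization: [hyp_i] gives the same limit to the variance of the sum and to the
    sum of the variances. *)
Lemma increment_cov_cvg (s1 s2 t1 t2 : R) :
  0 <= s1 -> s1 < s2 -> s2 <= t1 -> t1 < t2 -> t2 <= 1 ->
  cov P (increment s1 s2 n) (increment t1 t2 n) @[n --> \oo] --> (0 : R).
Proof.
move=> s10 s12 st t12 t21.
have h := hyp_i s10 s12 st t12 t21.
have h1 := window_var_cvg s10 s12 (le_trans st (le_trans (ltW t12) t21)).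
have h2 := window_var_cvg (le_trans s10 (le_trans (ltW s12) st)) t12 t21.
have h3 : 2^-1 * (var P (psum X (ipart n s1) (ipart n s2) \+
    psum X (ipart n t1) (ipart n t2)) / stdev_S X n ^+ 2 -
    var P (psum X (ipart n s1) (ipart n s2)) / stdev_S X n ^+ 2 -
    var P (psum X (ipart n t1) (ipart n t2)) / stdev_S X n ^+ 2) @[n --> \oo] -->
    2^-1 * (a s2 - a s1 + (a t2 - a t1) - (a s2 - a s1) - (a t2 - a t1)).
  by apply: cvgMr; apply: cvgB => //; apply: cvgB.
have E0 : 2^-1 * (a s2 - a s1 + (a t2 - a t1) - (a s2 - a s1) - (a t2 - a t1)) = 0.
  by ring.
rewrite E0 in h3; apply: (cvg_near_eq _ h3); apply: nearW => n.
rewrite /increment covZl ?LfunZ// covZr// !var_cov//; last exact: LfunD.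
set A := psum _ _ _; set B := psum _ _ _.
have -> : cov P (A \+ B) (A \+ B) = cov P A A + cov P B B + 2 * cov P A B.
  have lA : A \in Lfun P 2%:E by exact: lpsum.
  have lB : B \in Lfun P 2%:E by exact: lpsum.
  have -> : A \+ B = (fun w => A w + B w) by [].
  rewrite (covDl lA lB (LfunD l21 lA lB)) (covDr lA lB lA) (covDr lA lB lB).
  by rewrite (covC P B A); ring.
rewrite -exprVn; set c := (stdev_S X n)^-1; by field.
Qed.

Lemma dominated_increment (s t : R) n : t <= 1 ->
  dominated X n (increment s t n) (increment s t n).
Proof.
move=> t1; apply: dominatedZ; first by rewrite invr_ge0 sqrtr_ge0.
by apply: dominated_psum; rewrite -[leqRHS]ipart1; exact: ipart_le.
Qed.

Lemma YprocE n (t : R) w : Yproc X n t w = increment 0 t n w.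
Proof.
rewrite /Yproc /increment ipart0 mulrC; case: (leP 1 (n%:R * t)) => h.
  by rewrite mul1r mulrC.
have -> : ipart n t = 0%N.
  by apply/truncn0Pn; rewrite -ltNge.
by rewrite mul0r /psum big_geq// mulr0.
Qed.

Lemma increment_sum n m (tau : nat -> R) w :
  (forall j, (j < m)%N -> tau j <= tau j.+1) ->
  \sum_(j < m) increment (tau j) (tau j.+1) n w = increment (tau 0%N) (tau m) n w.
Proof.
elim: m => [|m IH] tauS.
  by rewrite big_ord0 /increment /psum big_geq ?mulr0.
rewrite big_ord_recr/= IH; last by move=> j jm; apply: tauS; exact: ltnW.
rewrite /increment -mulrDr psum_cat//; apply/andP; split; last exact: ipart_le (tauS _ _).
elim: m {IH} tauS => [//|m IH] tauS.
apply: leq_trans (IH _) _; first by move=> j jm; apply: tauS; exact: ltnW.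
by apply: ipart_le; apply: tauS; exact: ltnW.
Qed.

Context d' (T' : measurableType d') (Q : probability T' R) (W : R -> {RV Q >-> R}).
Hypothesis a0 : a 0 = 0.
Hypothesis W_wiener : standard_wiener W.
Hypothesis hyp_ii : forall s t : R, 0 <= s -> s < t -> t <= 1 ->
  block_hypotheses X s t.

Lemma time_change_itv (t : R) : 0 <= t <= 1 -> 0 <= a t <= 1.
Proof.
move=> /andP[t0 t1]; have a1 : a 1 = 1 by have := time_change1; rewrite a0 subr0.
by rewrite -{1}a0 -[X in _ && (_ <= X)]a1 !time_change_homo.
Qed.

(** If [a s = a t] the increment of [W o a] is 0 and that of the partial sums tends
    to 0 in mean square; only otherwise are the blocks of the window used. *)
Lemma increment_clt (s t : R) (h : R -> R) (L K : R) : 0 <= s -> s < t -> t <= 1 ->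
  0 < K -> lipschitz_fun L h -> (forall x, 0 <= h x <= 1) ->
  (forall x, K <= `|x| -> h x = 0) ->
  mean P (h \o increment s t n) @[n --> \oo] -->
  mean Q (fun w => h (W (a t) w - W (a s) w)).
Proof.
move=> s0 st t1 K0 hL h01 hK.
have s01 : 0 <= s <= 1 by rewrite s0 (le_trans (ltW st)).
have t01 : 0 <= t <= 1 by rewrite t1 (le_trans s0 (ltW st)).
have /andP[as0 as1] := time_change_itv s01; have /andP[at0 at1] := time_change_itv t01.
have := time_change_homo s0 (ltW st) t1; rewrite le_eqVlt => /predU1P[ast|ast].
  have -> : mean Q (fun w => h (W (a t) w - W (a s) w)) = h 0.
    rewrite -[RHS](mean_cst Q); congr mean; apply/funext => w.
    by rewrite ast subrr.
  have hM x : `|h x| <= 1 by have /andP[? ?] := h01 x; rewrite ger0_norm.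
  have := lipschitz_mean_cvg hL hM (fun n => Lfun2_increment s t n)
    (fun n => Lfun_cst P 0 2).
  have -> : (fun n => mean P (fun w => (increment s t n w - cst 0 w) ^+ 2)) =
      (fun n => mean P (fun w => increment s t n w ^+ 2)).
    by apply/funext => n; congr mean; apply/funext => w; rewrite subr0.
  have := increment_var_cvg s0 st t1; rewrite ast subrr => v0 /(_ v0) h0.
  rewrite -[X in _ --> X]add0r; apply: (cvg_near_eq _ (cvgD h0 (cvg_cst (h 0)))).
  apply: nearW => n /=.
  have -> : mean P (h \o cst 0) = h 0 by rewrite -[RHS](mean_cst P).
  by rewrite subrK.
have [l [m [r blocks]]] := hyp_ii s0 st t1.
pose sigma := Num.sqrt (a t - a s).
have sigma0 : 0 < sigma by rewrite sqrtr_gt0 subr_gt0.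
have wc := window_var_cvg s0 st t1.
rewrite -[X in _ --> X]sqr_sqrtr ?subr_ge0 1?ltW// -/sigma in wc.
rewrite (wiener_increment_law W_wiener)//; last by split => //; exact: lipschitz_measurable hL.
exact: (window_clt X_sqint X_centered X_assoc s_pos st sigma0 blocks wc K0 hL hK).
Qed.

Section partition.
Variables (q : nat) (tau : nat -> R).
Hypothesis tau0 : tau 0%N = 0.
Hypothesis tauS : forall j, (j < q)%N -> tau j < tau j.+1.
Hypothesis tauq : tau q <= 1.

Let tau_le i j : (i <= j <= q)%N -> tau i <= tau j.
Proof.
move=> /andP[]; elim: j => [|j IH]; first by rewrite leqn0 => /eqP ->.
rewrite leq_eqVlt => /predU1P[-> //|]; rewrite ltnS => ij jq.
by rewrite (le_trans (IH ij (ltnW jq)))// ltW// tauS.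
Qed.

Let tau_ge0 j : (j <= q)%N -> 0 <= tau j.
Proof. by move=> jq; rewrite -tau0 tau_le. Qed.

Let tau_le1 j : (j <= q)%N -> tau j <= 1.
Proof. by move=> jq; rewrite (le_trans _ tauq)// tau_le// jq leqnn. Qed.

Let U n (j : 'I_q) := increment (tau j) (tau j.+1) n.
Let Z (j : 'I_q) w := W (a (tau j.+1)) w - W (a (tau j)) w.

Let U_cov (i j : 'I_q) : i != j -> cov P (U n i) (U n j) @[n --> \oo] --> (0 : R).
Proof.
have lt_cov (i' j' : 'I_q) : (i' < j')%N ->
    cov P (U n i') (U n j') @[n --> \oo] --> (0 : R).
  move=> ij; apply: increment_cov_cvg.
  - by apply: tau_ge0; exact: ltnW.
  - exact: tauS.
  - by apply: tau_le; rewrite ij ltnW.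
  - exact: tauS.
  - exact: tau_le1.
rewrite neq_ltn => /orP[|] ij; first exact: lt_cov.
by under eq_fun do rewrite covC; exact: lt_cov.
Qed.

Let UZ (h : 'I_q -> R -> R) (L K : R) : 0 < K ->
  (forall i, lipschitz_fun L (h i)) -> (forall i x, 0 <= h i x <= 1) ->
  (forall i x, K <= `|x| -> h i x = 0) ->
  mean P (fun w => \prod_i h i (U n i w)) @[n --> \oo] -->
  mean Q (fun w => \prod_i h i (Z i w)).
Proof.
move=> K0 hL h01 hK.
(* [wiener_increments_mean] takes a family indexed by all natural numbers *)
pose h' (j : nat) : R -> R := if insub j is Some i then h i else fun=> 0.
have h'E (i : 'I_q) : h' i = h i by rewrite /h' valK.
have h'u j : unit_measurable (h' j).
  rewrite /h'; case: insubP => [i _ _|_]; last by split => // x; rewrite lexx ler01.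
  by split; [exact: lipschitz_measurable (hL i)|exact: h01].
have -> : mean Q (fun w => \prod_i h i (Z i w)) = \prod_i mean Q (h i \o Z i).
  have v0 : 0 <= a (tau 0%N) by rewrite tau0 a0.
  have vq : a (tau q) <= 1.
    have tq : 0 <= tau q <= 1 by rewrite tau_ge0// tauq.
    by case/andP: (time_change_itv tq).
  have vS i : (i < q)%N -> a (tau i) <= a (tau i.+1).
    by move=> iq; apply: time_change_homo; [exact: tau_ge0 (ltnW iq)|
      exact: ltW (tauS iq)|exact: tau_le1].
  have -> : \prod_i mean Q (h i \o Z i) =
      \prod_(i < q) mean Q (fun w => h' i (W (a (tau i.+1)) w - W (a (tau i)) w)).
    by apply: eq_bigr => i _; rewrite h'E.
  rewrite -(wiener_increments_mean W_wiener v0 vS vq h'u).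
  by congr mean; apply/funext => w; apply: eq_bigr => i _; rewrite h'E.
rewrite -[X in _ --> X]add0r.
have ind := @asymptotic_independence _ _ _ P X X_assoc id q (fun i n => U n i) h (fun=> L)
  (fun i n => Lfun2_increment _ _ n)
  (fun i n => dominated_increment _ n (tau_le1 (ltn_ord i))) hL h01 U_cov.
have marg : \prod_i mean P (h i \o U n i) @[n --> \oo] --> \prod_i mean Q (h i \o Z i).
  apply: cvg_prodr => i _; apply: (increment_clt _ (tauS _) _ K0 (hL i)) => //.
  - by apply: tau_ge0; exact: ltnW.
  - exact: tau_le1.
  - exact: hK.
apply: (cvg_near_eq _ (cvgD ind marg)); apply: nearW => n /=.
by rewrite subrK.
Qed.

Lemma increments_weak_cvg (g : 'rV[R]_q -> R) G : continuous g ->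
  (forall x, `|g x| <= G) ->
  mean P (fun w => g (\row_i U n i w)) @[n --> \oo] --> mean Q (fun w => g (\row_i Z i w)).
Proof.
move=> cg gG; apply: (weak_cvg_product_test (C := 2) _ _ _ UZ cg gG).
- by move=> n i; exact: Lfun2_increment.
- move=> i; have i0 : 0 <= tau i by apply: tau_ge0; exact: ltnW.
  have i1 : tau i.+1 <= 1 by exact: tau_le1.
  apply: (cvgr_le _ (increment_var_cvg i0 (tauS (ltn_ord i)) i1)).
  have /andP[h1 h2] : 0 <= a (tau i) <= 1.
    by apply: time_change_itv; rewrite i0 tau_le1// ltnW.
  have /andP[h3 h4] : 0 <= a (tau i.+1) <= 1.
    by apply: time_change_itv; rewrite i1 tau_ge0.
  lra.
- by move=> i; apply: measurable_funB; exact: measurable_funP.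
Qed.

End partition.

Section marginals.
Variables (k : nat) (t : 'I_k -> R).
Hypothesis t01 : forall i, 0 <= t i <= 1.

Let times : seq R := sort <=%R (undup (0 :: codom t)).
Let tau j := nth 0 times j.
Let q := (size times).-1.

Let size_times : size times = q.+1.
Proof.
rewrite /q prednK// -has_predT; apply/hasP; exists 0 => //.
by rewrite mem_sort mem_undup mem_head.
Qed.

Let times_sorted : sorted <%R times.
Proof. by rewrite sort_lt_sorted undup_uniq. Qed.

Let times_itv x : x \in times -> 0 <= x <= 1.
Proof.
rewrite mem_sort mem_undup inE => /predU1P[->|]; first by rewrite lexx ler01.
by move=> /codomP[i ->]; exact: t01.
Qed.

Let tauS j : (j < q)%N -> tau j < tau j.+1.
Proof.
move=> jq; apply: (sorted_ltn_nth lt_trans) => //; rewrite inE size_times ltnS//.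
exact: ltnW.
Qed.

Let tau_mem j : (j <= q)%N -> tau j \in times.
Proof. by move=> jq; rewrite mem_nth// size_times. Qed.

Let tau0 : tau 0%N = 0.
Proof.
have := tau_mem (leq0n q); move=> /times_itv/andP[h _].
have z : 0 \in times by rewrite mem_sort mem_undup mem_head.
have z0 : tau (index 0 times) = 0 by rewrite /tau nth_index.
have [//|iN0] := eqVneq (index 0 times) 0%N; first by move=> i0; rewrite -[in LHS]i0.
have : tau 0%N < tau (index 0 times).
  apply: (sorted_ltn_nth lt_trans) => //; last by rewrite lt0n.
  - by rewrite inE size_times.
  - by rewrite inE index_mem.
by rewrite z0 ltNge h.
Qed.

Let tauq : tau q <= 1.
Proof. by have := tau_mem (leqnn q) => /times_itv/andP[]. Qed.

Let pos i := index (t i) times.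

Let tau_pos i : tau (pos i) = t i.
Proof. by rewrite /tau nth_index// mem_sort mem_undup inE codom_f orbT. Qed.

Let pos_le i : (pos i <= q)%N.
Proof.
by rewrite -ltnS -size_times index_mem mem_sort mem_undup inE codom_f orbT.
Qed.

(** Recovers the values at the times [t i] from the increments over the partition;
    an index [pos i] counts the increments that precede [t i]. *)
Let sum_row (x : 'rV[R]_q) : 'rV[R]_k := \row_i \sum_(j < q | (j < pos i)%N) x 0 j.

Let continuous_sum_row : continuous sum_row.
Proof.
apply: continuous_row_mx => i x.
have FF : Filter (nbhs x) by exact: nbhs_filter.
by apply: cvg_big; [exact: add_continuous|move=> j _; exact: coord_continuous].
Qed.

(** [W (a 0)] is 0 only almost everywhere, so on the Wiener side the marginals and
    the linear image of the increments agree almost everywhere. *)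
Lemma marginal_cvg (f : 'rV[R]_k -> R) : continuous f -> bounded_fun f ->
  ('E_P[f \o (fun w => \row_i Yproc X n (t i) w)] @[n --> \oo] -->
   'E_Q[f \o (fun w => \row_i W (a (t i)) w)])%E.
Proof.
move=> cf [M [_ fM]].
pose G := M + 1.
have fG x : `|f x| <= G by apply: (fM G) => //; rewrite ltrDl.
have cg : continuous (f \o sum_row).
  by move=> x; apply: continuous_comp; [exact: continuous_sum_row|exact: cf].
have mW s : measurable_fun setT (W s) by exact: measurable_funP.
have mY n s : 0 <= s -> measurable_fun setT (Yproc X n s).
  move=> s0; have -> : Yproc X n s = increment 0 s n by apply/funext => w; exact: YprocE.
  exact: Lfun_measurable (Lfun2_increment _ _ _).
have lY n : (f \o (fun w => \row_i Yproc X n (t i) w)) \in Lfun P 1.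
  apply: (@Lfun1_bounded _ _ _ _ _ G) => [|w]; last exact: fG.
  by apply: measurable_continuous_row => // i; apply: mY; case/andP: (t01 i).
have lW : (f \o (fun w => \row_i W (a (t i)) w)) \in Lfun Q 1.
  apply: (@Lfun1_bounded _ _ _ _ _ G) => [|w]; last exact: fG.
  by apply: (@measurable_continuous_row _ _ _ _ (fun i => W (a (t i)))).
under eq_fun do rewrite expectation_mean//; rewrite expectation_mean//.
apply: cvg_EFin; first exact: nearW.
have := increments_weak_cvg tau0 tauS tauq cg (fun x => fG (sum_row x)).
have -> : mean Q (fun w => (f \o sum_row)
    (\row_i (W (a (tau i.+1)) w - W (a (tau i)) w))) =
    mean Q (f \o (fun w => \row_i W (a (t i)) w)).
  rewrite /mean /Rintegral; congr fine; apply: ae_eq_integral => //.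
  - apply/measurable_EFinP.
    apply: (@measurable_continuous_row _ _ _ _
      (fun (i : 'I_q) w => W (a (tau i.+1)) w - W (a (tau i)) w) _ _ cg) => i.
    by apply: measurable_funB.
  - apply/measurable_EFinP.
    exact: (@measurable_continuous_row _ _ _ _ (fun i => W (a (t i)))).
  - apply: filterS (wiener0 W_wiener) => w W0 _ /=; congr (f _)%:E.
    apply/rowP => i; rewrite !mxE.
    under eq_bigr do rewrite mxE.
    rewrite -(big_ord_widen _ (fun j => W (a (tau j.+1)) w - W (a (tau j)) w) (pos_le i)).
    rewrite -(big_mkord xpredT (fun j => W (a (tau j.+1)) w - W (a (tau j)) w)).
    by rewrite telescope_sumr// tau_pos tau0 a0 W0 subr0.
apply: cvg_near_eq; apply: nearW => n; congr mean; apply/funext => w /=.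
congr (f _); apply/rowP => i; rewrite !mxE YprocE.
under [RHS]eq_bigr do rewrite mxE.
rewrite -(big_ord_widen _ (fun j => increment (tau j) (tau j.+1) n w) (pos_le i)).
rewrite increment_sum ?tau_pos ?tau0// => j jp.
by rewrite ltW// tauS// (leq_trans jp).
Qed.

End marginals.

End increments.

Theorem theorem7 (R : realType)
    (d : measure_display) (T : measurableType d) (P : probability T R)
    (X : nat -> {RV P >-> R}) (a : R -> R)
    (d' : measure_display) (T' : measurableType d') (Q : probability T' R)
    (W : R -> {RV Q >-> R})
    (X_assoc : associated X)
    (X_centered : forall j : nat, (1 <= j)%N -> ('E_P[X j] = 0)%E)
    (X_sqint : forall j : nat, (1 <= j)%N -> (X j : T -> R) \in Lfun P 2%:E)
    (s_pos : \forall n \near \oo, 0 < stdev_S X n)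
    (a_meas : measurable_fun (`[0, 1] : set R) a)
    (a0 : a 0 = 0)
    (hyp_i : forall s1 s2 t1 t2 : R,
      0 <= s1 -> s1 < s2 -> s2 <= t1 -> t1 < t2 -> t2 <= 1 ->
      var P (psum X (ipart n s1) (ipart n s2) \+
             psum X (ipart n t1) (ipart n t2)) / stdev_S X n ^+ 2
        @[n --> \oo] --> (a s2 - a s1) + (a t2 - a t1))
    (hyp_ii : forall s t : R, 0 <= s -> s < t -> t <= 1 ->
      block_hypotheses X s t)
    (W_wiener : standard_wiener W) :
  cvg_fdd P Q (Yproc X) (fun t => W (a t)).
Proof.
move=> k t t01 f cf bf.
exact: (marginal_cvg X_assoc X_centered X_sqint s_pos hyp_i a0 W_wiener hyp_ii t01).
Qed.
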